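(* Let $0<\gamma<1$, $\kappa_\gamma>0$, $\lambda\ge 0$, let $x_l<x_r$ be real numbers, put $\Omega_i=(x_l,x_r)$, and let $u_0$ be a real-valued function whose support is contained in $\Omega_i$. Let $u(x,t)$ be a real-valued solution (with the regularity described in the context) of the initial-boundary value problem $${}_{0}^{C}D_t^{\gamma}\big(e^{\lambda t}u(x,t)\big)=\kappa_\gamma\big(e^{\lambda t}u(x,t)\big)_{xx},\qquad x\in\Omega_i,\ t>0,$$ $$u(x,0)=u_0(x),\qquad x\in\Omega_i,$$ $$\big(e^{\lambda t}u(x,t)\big)_x=\frac{1}{\sqrt{\kappa_\gamma}}\,{}_{0}^{C}D_t^{\frac{\gamma}{2}}\big(e^{\lambda t}u(x,t)\big),\qquad x=x_l,\ t>0,$$ $$\big(e^{\lambda t}u(x,t)\big)_x=-\frac{1}{\sqrt{\kappa_\gamma}}\,{}_{0}^{C}D_t^{\frac{\gamma}{2}}\big(e^{\lambda t}u(x,t)\big),\qquad x=x_r,\ t>0.$$ Then for every $t>0$, $$\|u(\cdot,t)\|^2+2\kappa_\gamma\,{}_{0}D_t^{-\gamma,2\lambda}\|u_x(\cdot,t)\|^2\le e^{-2\lambda t}\|u_0\|^2 .$$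
   Context: Here $\|w\|^2=\int_{\Omega_i}w(x)^2\,dx$ is the squared $L^2(\Omega_i)$ norm. All fractional operators act in the variable $t$. For $0<\alpha<1$ the Caputo fractional derivative is $${}_{0}^{C}D_t^{\alpha}f(t)=\frac{1}{\Gamma(1-\alpha)}\int_0^t\frac{f'(s)}{(t-s)^{\alpha}}\,ds .$$ For $0<\gamma<1$ and $\mu\in\mathbb{R}$, the (tempered) Riemann-Liouville fractional integral is $${}_{0}D_t^{-\gamma,\mu}f(t)=\frac{1}{\Gamma(\gamma)}\int_0^t e^{-\mu(t-s)}(t-s)^{\gamma-1}f(s)\,ds ,$$ so that ${}_{0}D_t^{-\gamma,2\lambda}\|u_x(\cdot,t)\|^2=\frac{1}{\Gamma(\gamma)}\int_0^t e^{-2\lambda(t-s)}(t-s)^{\gamma-1}\|u_x(\cdot,s)\|^2\,ds$. Regularity convention: $u$, $u_x$, $u_{xx}$ are continuous on $[x_l,x_r]\times[0,\infty)$; $u_t$ exists and is continuous on $[x_l,x_r]\times(0,\infty)$, with $\sup_{x\in[x_l,x_r]}|u_t(x,t)|\le g(t)$ for some $g$ that is integrable on $(0,T)$ for every $T>0$; all fractional derivatives appearing in the problem exist, and the equations hold pointwise. The initial condition extends to the closed interval by continuity, so $u(x_l,0)=u(x_r,0)=0$ because $u_0$ is supported in $\Omega_i$. *)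

(* Defs.v *)
From HB Require Import structures.
From mathcomp Require Import all_boot all_order all_algebra.
From mathcomp Require Import all_classical all_reals all_analysis.

Set Implicit Arguments.
Unset Strict Implicit.
Unset Printing Implicit Defensive.

Import Order.TTheory GRing.Theory Num.Theory numFieldNormedType.Exports.
Local Open Scope classical_set_scope.
Local Open Scope ring_scope.

Section Fractional.
Context {R : realType}.
Implicit Types (a mu t x : R) (f g : R -> R) (I : set R) (u : R -> R -> R).

Local Notation leb := (@lebesgue_measure R).

Definition Gamma a : R :=
  \int[leb]_(s in `]0, +oo[) (s `^ (a - 1) * expR (- s)).

(* The open interval keeps out s = 0, where f need not be differentiable, and
   s = t, where the kernel is singular. *)
Definition caputo_kernel a f t : R -> R :=
  fun s => derive1 f s / (t - s) `^ a.

Definition caputo a f t : R :=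
  (Gamma (1 - a))^-1 * \int[leb]_(s in `]0, t[) caputo_kernel a f t s.

(* [caputo] is a total function; this says that its value is meaningful. *)
Definition caputo_exists a f t : Prop :=
  (forall s, 0 < s < t -> derivable f s 1) /\
  leb.-integrable `]0, t[ (EFin \o caputo_kernel a f t).

(* Riemann-Liouville integral of order a with tempering parameter mu. *)
Definition tempered_RL a mu f t : R :=
  (Gamma a)^-1 *
  \int[leb]_(s in `]0, t[) (expR (- mu * (t - s)) * (t - s) `^ (a - 1) * f s).

(* Derivatives relative to a set I: two-sided in the interior of an interval,
   one-sided at an endpoint that belongs to it. *)
Definition quotient_within f x : R -> R := fun y => (f y - f x) / (y - x).

Definition derivable_within I f x : Prop :=
  cvg (quotient_within f x @ within I x^').

Definition derive_within I f x : R :=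
  lim (quotient_within f x @ within I x^').

(* For u : R -> R -> R the arguments are the space variable and the time, in
   this order. *)
Definition dx I u : R -> R -> R := fun x t => derive_within I (u^~ t) x.

Definition dt u : R -> R -> R := fun x t => derive1 (u x) t.

Definition sqL2norm I f : R := \int[leb]_(x in I) (f x) ^+ 2.

Definition continuous_on2 I (J : set R) u : Prop :=
  {within I `*` J, continuous (fun p : R * R => u p.1 p.2)}.

Definition regular_in_space I u : Prop :=
  [/\ forall x t, I x -> 0 <= t ->
        derivable_within I (u^~ t) x /\ derivable_within I ((dx I u)^~ t) x,
      continuous_on2 I `[0, +oo[ u,
      continuous_on2 I `[0, +oo[ (dx I u) &
      continuous_on2 I `[0, +oo[ (dx I (dx I u))].

Definition regular_in_time I u : Prop :=
  [/\ forall x t, I x -> 0 < t -> derivable (u x) t 1,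
      continuous_on2 I `]0, +oo[ (dt u) &
      exists g,
        (forall T : R, 0 < T -> leb.-integrable `]0, T[ (EFin \o g)) /\
        (forall x t, I x -> 0 < t -> `|dt u x t| <= g t)].

(* The closure makes this the topological support. *)
Definition supp f : set R := closure [set x | f x != 0].

End Fractional.

(* Main.v *)
Require Import Defs.
From HB Require Import structures.
From mathcomp Require Import all_boot all_order all_algebra.
From mathcomp Require Import all_classical all_reals all_analysis.
From mathcomp Require Import measurable_realfun ring lra.

Set Implicit Arguments.
Unset Strict Implicit.
Unset Printing Implicit Defensive.

Import Order.TTheory GRing.Theory Num.Theory numFieldNormedType.Exports.
Local Open Scope classical_set_scope.
Local Open Scope ring_scope.

(** With w = exp (lambda t) u, the Caputo derivative D^a of order a < 1 satisfies
    Alikhanov's inequality 2 w D^a w >= D^a (w ^ 2): the difference is an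
    integral that becomes nonnegative after integrating by parts the derivative
    of (w t - w s) ^ 2 against the kernel (t - s)^(-a).  Applying the fractional
    integral I^g of order g = gamma turns D^g (w ^ 2) into
    w(t) ^ 2 - w(0) ^ 2, because Beta(1 - g, g) = Gamma (1 - g) * Gamma g, and
    turns D^(g/2) (w ^ 2) into a positive multiple of the integral of
    (t - s)^(g/2) (w ^ 2)', which is nonnegative when w 0 = 0.  Integrate
    w(x, t) ^ 2 - w(x, 0) ^ 2 <= 2 kappa I^g (w w_xx)(x, t) over x, exchange the
    integrals and integrate by parts in x: the boundary terms are negative
    multiples of I^g (w D^(g/2) w) at the endpoints, where w vanishes at t = 0,
    so they can be dropped. *)

(** * Affine change of variable *)

Section affine_change_of_variable.
Context {R : realType}.
Local Notation mu := (@lebesgue_measure R).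

(** Integrating by parts in Alikhanov's inequality produces alpha (t - s)^(-alpha - 1) (w t - w
    s)^2, which is singular at s = t. It is nonnegative, so it is discarded inside a monotonicity
    argument: only an inequality is proved, and the integrability of this term is never discussed.
    The time derivative may blow up at t = 0; it is only dominated by an integrable function. That w
    D^a w is integrable against (t - s)^(gamma - 1) is therefore read off the problem itself: the
    equation and the boundary conditions identify the Caputo derivatives with multiples of w_xx and
    w_x, which are continuous up to t = 0. The initial condition is given on the open interval, so
    the zero values at the two endpoints come from a limit, using that the support of u_0 is closed.
    Tempering costs nothing: exp(-2 lambda (t - s)) = exp(-2 lambda t) exp(2 lambda s), and the
    second factor turns the squared norm of u_x into that of w_x. The tempered estimate for u is the
    plain estimate for w divided by exp(2 lambda t). *)

Lemma measurable_affine (c v : R) :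
  measurable_fun [set: R] (fun x : R => c + v * x).
Proof. by apply: measurable_funD => //; exact: measurable_funM. Qed.

(** A measure with the values of Lebesgue measure on half-open intervals is Lebesgue measure; v
    times the pushforward under x -> c + v x is such a measure. *)
Lemma lebesgue_measure_affine (c v : R) (v0 : 0 < v) (A : set R) : measurable A ->
  (v%:E * mu ((fun x : R => c + v * x)%R @^-1` A) = mu A)%E.
Proof.
move=> mA; apply/esym.
pose phi : measurableTypeR R -> measurableTypeR R := fun x => c + v * x.
have mphi : measurable_fun setT phi := measurable_affine c v.
pose m0 : {measure set (measurableTypeR R) -> \bar R} := pushforward mu phi.
pose m1 := mscale (NngNum (ltW v0)) (m0 mphi).
transitivity (m1 A); last by [].
apply: lebesgue_measure_unique => //= _ [[a b]] _ <-.
rewrite /m1 /= /mscale/= /pushforward.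
rewrite (_ : _ @^-1` _ = `](a - c) / v, (b - c) / v]%classic); last first.
  by apply/seteqP; split => x /=; rewrite !in_itv/= ltr_pdivrMr// ler_pdivlMr//
    ltrBlDl lerBrDl (mulrC x).
rewrite !lebesgue_measure_itv/= !lte_fin ltr_pM2r ?invr_gt0// ltrD2r.
case: ifPn => _; last by rewrite mule0.
by rewrite -!EFinB -EFinM; congr EFin; field; rewrite gt_eqF.
Qed.

Lemma ge0_integral_affine (c v : R) (f : R -> \bar R) : 0 < v ->
  measurable_fun [set: R] f -> (forall x, 0 <= f x)%E ->
  (\int[mu]_x f x = v%:E * \int[mu]_x f (c + v * x)%R)%E.
Proof.
move=> v0 mf f0.
pose phi : measurableTypeR R -> measurableTypeR R := fun x => c + v * x.
have mphi : measurable_fun setT phi := measurable_affine c v.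
have := @ge0_integral_pushforward _ _ _ _ R phi mphi mu setT f measurableT mf (fun x _ => f0 x).
rewrite preimage_setT => <-.
pose m0 : {measure set (measurableTypeR R) -> \bar R} := pushforward mu phi.
rewrite -(ge0_integral_mscale (m0 mphi) measurableT (NngNum (ltW v0))) //.
apply: eq_measure_integral => A mA _.
exact: (esym (lebesgue_measure_affine c v0 mA)).
Qed.

End affine_change_of_variable.

(** * Truncated powers, Beta and Gamma integrals *)

Section truncated_power.
Context {R : realType}.
Local Notation mu := (@lebesgue_measure R).
Implicit Types (a b x : R).

(* With x_+^a supported on the half-line, the fractional integrals become
   convolutions over the whole line. *)
Definition tpow a x : R := if 0 < x then x `^ a else 0.

Lemma tpow_ge0 a x : 0 <= tpow a x.
Proof. by rewrite /tpow; case: ifP => // _; exact: powR_ge0. Qed.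

Lemma gt0_tpow a x : 0 < x -> tpow a x = x `^ a.
Proof. by rewrite /tpow => ->. Qed.

Lemma le0_tpow a x : x <= 0 -> tpow a x = 0.
Proof. by rewrite /tpow ltNge => ->. Qed.

Lemma measurable_tpow a : measurable_fun [set: R] (tpow a).
Proof.
apply: (@measurable_fun_ifT _ _ _ _ (fun x => x `^ a) (cst 0) (fun x => 0 < x));
  [|exact: measurable_powR|]=> //.
exact: measurable_fun_ltr.
Qed.

Lemma measurable_tpow_comp d (T : measurableType d) a (f : T -> R) :
  measurable_fun [set: T] f -> measurable_fun [set: T] (fun z => tpow a (f z)).
Proof. by move=> mf; exact: (measurableT_comp (measurable_tpow a) mf). Qed.

Lemma tpowMl a v x : 0 < v -> tpow a (v * x) = v `^ a * tpow a x.
Proof.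
move=> v0; rewrite /tpow pmulr_rgt0//; case: ifPn => x0; last by rewrite mulr0.
by rewrite powRM// ltW.
Qed.

(** Beta and Gamma are taken in the extended reals so that Tonelli's theorem applies with no
    finiteness condition; finiteness is proved afterwards, for the exponents that occur. *)
Definition eBeta a b : \bar R :=
  (\int[mu]_x (tpow (a - 1) x * tpow (b - 1) (1 - x))%:E)%E.

Definition eGamma a : \bar R := (\int[mu]_x (tpow (a - 1) x * expR (- x))%:E)%E.

Lemma eGamma_ge0 a : (0 <= eGamma a)%E.
Proof. by apply: integral_ge0 => x _; rewrite lee_fin mulr_ge0 ?tpow_ge0 ?expR_ge0. Qed.

Lemma eBeta_ge0 a b : (0 <= eBeta a b)%E.
Proof. by apply: integral_ge0 => x _; rewrite lee_fin mulr_ge0 ?tpow_ge0. Qed.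

(** The substitution r = s + (t - s) x makes both factors homogeneous in t - s. No condition on the
    exponents: both sides may be infinite. *)
Lemma integral_tpow_conv a b s t : s < t ->
  (\int[mu]_r (tpow (a - 1) (r - s) * tpow (b - 1) (t - r))%:E =
   ((t - s) `^ (a + b - 1))%:E * eBeta a b)%E.
Proof.
move=> st; have v0 : 0 < t - s by rewrite subr_gt0.
pose f r : \bar R := (tpow (a - 1) (r - s) * tpow (b - 1) (t - r))%:E.
have mf : measurable_fun [set: R] f.
  by apply/measurable_EFinP; apply: measurable_funM;
    apply: measurable_tpow_comp; apply: measurable_funB.
have f0 r : (0 <= f r)%E by rewrite lee_fin mulr_ge0 ?tpow_ge0.
rewrite -/(f _) (ge0_integral_affine s v0 mf f0) {mf f0}/f.
under eq_integral => x _.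
  rewrite (_ : s + (t - s) * x - s = (t - s) * x); last by ring.
  rewrite (_ : t - (s + (t - s) * x) = (t - s) * (1 - x)); last by ring.
  rewrite !tpowMl// mulrACA EFinM.
  over.
rewrite ge0_integralZl_EFin//; last 3 first.
- by move=> x _; rewrite lee_fin mulr_ge0 ?tpow_ge0.
- apply/measurable_EFinP; apply: measurable_funM; apply: measurable_tpow_comp => //.
  by apply: measurable_funB.
- by rewrite mulr_ge0 ?powR_ge0.
rewrite muleA -EFinM; congr (_%:E * _)%E.
have tsD x y : (t - s) `^ (x + y) = (t - s) `^ x * (t - s) `^ y.
  by rewrite powRD// (gt_eqF v0) implybT.
rewrite -[X in X * _](@powRr1 _ (t - s)) ?(ltW v0)// -!tsD.
by congr (_ `^ _); ring.
Qed.

Lemma integral_expRN : (\int[mu]_(x in `]0%R, +oo[) (expR (- x))%:E = 1)%E.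
Proof.
rewrite integral_itv_obnd_cbnd; last first.
  by apply/measurable_EFinP; apply: measurable_funTS; apply: measurableT_comp.
rewrite -(@integral_exponential_pdf _ 1)// integral_mkcond.
apply: eq_integral => x _; rewrite /exponential_pdf !patchE.
by case: ifP => //; rewrite mul1r mulN1r.
Qed.

(** The product is a double integral of s^(a - 1) (r - s)^(b - 1) exp(-r), where r is the sum of the
    two Gamma variables. In the other order, the integral over s is r^(a + b - 1) Beta(a, b), whose
    power is 1 here, and the integral of exp(-r) that remains is 1. *)
Lemma eGamma_mulC1 a b : a + b = 1 -> (eGamma a * eGamma b = eBeta a b)%E.
Proof.
move=> ab1.
pose k (z : R * R) : \bar R :=
  (tpow (a - 1) z.1 * tpow (b - 1) (z.2 - z.1) * expR (- z.2))%:E.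
have mk : measurable_fun [set: R * R] k.
  apply/measurable_EFinP; apply: measurable_funM; last first.
    by apply: measurableT_comp => //; apply: measurableT_comp.
  apply: measurable_funM; apply: measurable_tpow_comp => //.
  by apply: measurable_funB.
have k0 z : (0 <= k z)%E by rewrite lee_fin !mulr_ge0 ?tpow_ge0 ?expR_ge0.
transitivity (\int[mu]_s \int[mu]_r k (s, r))%E.
  rewrite {1}/eGamma -ge0_integralZr//; last 3 first.
  - apply/measurable_EFinP; apply: measurable_funM; first exact: measurable_tpow.
    by apply: measurableT_comp.
  - by move=> x _; rewrite lee_fin mulr_ge0 ?tpow_ge0 ?expR_ge0.
  - exact: eGamma_ge0.
  apply: eq_integral => s _.
  have := @ge0_integral_affine _ s 1 (fun r => k (s, r)) ltr01.
  move=> /(_ (measurableT_comp mk (pair1_measurable s)) (fun=> k0 _)) ->.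
  rewrite mul1e /eGamma -ge0_integralZl_EFin//; last 3 first.
  - by move=> x _; rewrite lee_fin mulr_ge0 ?tpow_ge0 ?expR_ge0.
  - apply/measurable_EFinP; apply: measurable_funM; first exact: measurable_tpow.
    by apply: measurableT_comp.
  - by rewrite mulr_ge0 ?tpow_ge0 ?expR_ge0.
  apply: eq_integral => x _; rewrite /k /= -EFinM mul1r (addrC s) addrK.
  by rewrite opprD expRD; congr EFin; ring.
rewrite fubini_tonelli//.
transitivity (\int[mu]_r (((expR (- r))%:E * eBeta a b) * (\1_`]0%R, +oo[ r)%:E))%E.
  apply: eq_integral => r _; rewrite indicE mem_setE in_itv/= andbT.
  have [r0|r0] := ltP 0 r.
    have := integral_tpow_conv a b r0.
    rewrite subr0 ab1 subrr powRr0 mul1e => <-.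
    rewrite mule1 -ge0_integralZl_EFin//; last 2 first.
    - by move=> x _; rewrite lee_fin mulr_ge0 ?tpow_ge0.
    - by apply/measurable_EFinP; apply: measurable_funM; apply: measurable_tpow_comp;
        apply: measurable_funB.
    by apply: eq_integral => s _; rewrite /k /= subr0 -EFinM mulrC.
  rewrite mule0; apply: integral0_eq => s _; rewrite /k/=.
  have [s0|s0] := ltP 0 s; last by rewrite (le0_tpow _ s0) !mul0r.
  by rewrite (@le0_tpow _ (r - s)) ?mulr0 ?mul0r// subr_le0 (le_trans r0)// ltW.
under eq_integral do rewrite muleAC.
rewrite ge0_integralZr//; last 2 first.
- apply: emeasurable_funM; apply/measurable_EFinP; first exact: measurableT_comp.
  exact: measurable_indic.
- exact: eBeta_ge0.
rewrite -[RHS]mul1e; congr (_ * _)%E.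
rewrite -integral_expRN [in RHS]integral_mkcond.
by apply: eq_integral => r _; rewrite patchE indicE; case: ifP; rewrite ?mule1 ?mule0.
Qed.

End truncated_power.

Section Gamma_facts.
Context {R : realType}.
Local Notation mu := (@lebesgue_measure R).
Implicit Types a b : R.

Lemma GammaE a : Gamma a = fine (eGamma a).
Proof.
rewrite /Gamma /Rintegral integral_mkcond /eGamma; congr fine.
apply: eq_integral => x _; rewrite patchE /tpow mem_setE in_itv/= andbT.
by case: ifP => //; rewrite mul0r.
Qed.

(** For e < 1 the cutoff keeps the integrand continuous on [e, 1], so that the integral is (1 - e^a)
    / a; the bound is uniform in e, ready for monotone convergence. *)
Lemma integral_powR_itv_le a e : 0 < a -> 0 < e ->
  (\int[mu]_(x in `[e, 1%R[) (x `^ (a - 1))%:E <= (a^-1)%:E)%E.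
Proof.
move=> a0 e0; have [e1|e1] := ltP e 1; last first.
  by rewrite set_itv_ge ?integral_set0 ?lee_fin ?invr_ge0 ?ltW// bnd_simp -leNgt.
have cpow (p : R) : {in `[e, 1], continuous (fun x : R => x `^ p)}.
  move=> x; rewrite in_itv/= => /andP[ex _].
  apply: differentiable_continuous; apply/derivable1_diffP.
  by apply: derivable_powR; rewrite in_itv/= andbT (lt_le_trans e0).
rewrite integral_itv_bndo_bndc; last first.
  by apply/measurable_EFinP; apply: measurable_funTS; exact: measurable_powR.
rewrite (@continuous_FTC2 _ _ (fun x : R => a^-1 * x `^ a))//.
- rewrite powR1 mulr1 -EFinB lee_fin gerBl mulr_ge0 ?powR_ge0 ?invr_ge0 ?ltW//.
- by apply: continuous_in_subspaceT => x; rewrite inE; exact: cpow.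
- split.
  + move=> x; rewrite in_itv/= => /andP[ex _]; apply: derivableM => //.
    by apply: derivable_powR; rewrite in_itv/= andbT (lt_trans e0).
  + apply: cvg_at_right_filter; apply: cvgM; first exact: cvg_cst.
    by apply: cpow; rewrite in_itv/= lexx ltW.
  + apply: cvg_at_left_filter; apply: cvgM; first exact: cvg_cst.
    by apply: cpow; rewrite in_itv/= lexx ltW.
- move=> x; rewrite in_itv/= => /andP[ex _].
  have x0 : 0 < x := lt_trans e0 ex.
  have dx : derivable (fun x : R => x `^ a) x 1.
    by apply: derivable_powR; rewrite in_itv/= andbT.
  rewrite derive1Ml// powR_derive1 ?in_itv/= ?andbT//.
  by rewrite mulrA mulVf ?mul1r// gt_eqF.
Qed.

Lemma integral_powR01_le a : 0 < a ->
  (\int[mu]_(x in `]0%R, 1%R[) (x `^ (a - 1))%:E <= (a^-1)%:E)%E.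
Proof.
move=> a0; rewrite itv_open_bnd_bigcup.
have ndF : nondecreasing_seq (fun n : nat => `[0 + n.+1%:R^-1, 1[%classic : set R).
  move=> m n mn; apply/subsetPset; apply: subset_itvr.
  by rewrite bnd_simp !add0r lef_pV2 ?posrE// ler_nat ltnS.
set F := fun n : nat => _.
have cvF : (\int[mu]_(x in F n) (x `^ (a - 1))%:E @[n --> \oo] -->
    \int[mu]_(x in \bigcup_n F n) (x `^ (a - 1))%:E)%E.
  apply: ge0_nondecreasing_set_cvg_integral => //.
  - by move=> n; exact: measurable_itv.
  - by move=> n; apply/measurable_EFinP; apply: measurable_funTS; exact: measurable_powR.
  - by move=> n x _; rewrite lee_fin powR_ge0.
apply: (cvge_le _ cvF); apply: nearW => n.
by rewrite /F add0r; apply: integral_powR_itv_le.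
Qed.

(** The integrand is at most x^(a - 1) on ]0, 1[ and, because a < 1, at most exp(-x) beyond, which
    gives the bound 1/a + 1. *)
Lemma eGamma_lty a : 0 < a < 1 -> (eGamma a < +oo)%E.
Proof.
move=> /andP[a0 a1].
have m1 : measurable_fun [set: R] (fun x : R => (x `^ (a - 1))%:E).
  by apply/measurable_EFinP; exact: measurable_powR.
have m2 : measurable_fun [set: R] (fun x : R => (expR (- x))%:E).
  by apply/measurable_EFinP; exact: measurableT_comp.
apply: (@le_lt_trans _ _ ((a^-1)%:E + 1)%E); last by rewrite -EFinD ltry.
apply: le_trans (leeD (integral_powR01_le a0) (lexx _)).
rewrite -(@integral_expRN R) integral_mkcond [X in (_ + X)%E]integral_mkcond.
have p1 x : (0 <= ((fun x : R => (x `^ (a - 1))%:E) \_ `]0%R, 1%R[) x)%E.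
  by rewrite patchE; case: ifP => // _; rewrite lee_fin powR_ge0.
have p2 x : (0 <= ((fun x : R => (expR (- x))%:E) \_ `]0%R, +oo[) x)%E.
  by rewrite patchE; case: ifP => // _; rewrite lee_fin expR_ge0.
rewrite -ge0_integralD//; last 2 first.
- by apply/(measurable_restrictT _ _).1 => //; apply: measurable_funTS.
- by apply/(measurable_restrictT _ _).1 => //; apply: measurable_funTS.
apply: ge0_le_integral => //.
- by move=> x _; rewrite lee_fin mulr_ge0 ?tpow_ge0 ?expR_ge0.
- apply/measurable_EFinP; apply: measurable_funM; first exact: measurable_tpow.
  exact/measurable_EFinP.
- apply: emeasurable_funD.
    by apply/(measurable_restrictT _ _).1 => //; apply: measurable_funTS.
  by apply/(measurable_restrictT _ _).1 => //; apply: measurable_funTS.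
move=> x _; have [x0|x0] := leP x 0.
  by rewrite le0_tpow// mul0r adde_ge0.
rewrite gt0_tpow// !patchE !mem_setE !in_itv/= x0/=.
case: ifPn => x1.
  rewrite -EFinD lee_fin ler_wpDr ?expR_ge0// ler_piMr ?powR_ge0//.
  by rewrite -expR0 ler_expR oppr_le0 ltW.
rewrite add0e lee_fin ler_piMl ?expR_ge0//.
rewrite -leNgt in x1; rewrite -[leRHS](powRr0 x) ler_powR// subr_le0 ltW//.
Qed.

(** On ]0, 1[ the power is at least 1, because a < 1, and the exponential is at least exp(-1). *)
Lemma eGamma_gt0 a : 0 < a < 1 -> (0 < eGamma a)%E.
Proof.
move=> /andP[a0 a1].
apply: (@lt_le_trans _ _ (\int[mu]_(x in `]0%R, 1%R[) (expR (- 1))%:E)%E).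
  rewrite integral_cst//= lebesgue_measure_itv/= lte_fin ltr01 sube0 mule1.
  by rewrite lte_fin expR_gt0.
rewrite integral_mkcond; apply: ge0_le_integral => //.
- by move=> x _; rewrite patchE; case: ifP => // _; rewrite lee_fin expR_ge0.
- by apply/(measurable_restrictT _ _).1.
- apply/measurable_EFinP; apply: measurable_funM; first exact: measurable_tpow.
  exact: measurableT_comp.
move=> x _; rewrite patchE mem_setE in_itv/=; case: ifPn; last first.
  by rewrite lee_fin mulr_ge0 ?tpow_ge0 ?expR_ge0.
move=> /andP[x0 x1]; rewrite lee_fin gt0_tpow// -[leLHS]mul1r.
apply: ler_pM => //.
  by rewrite -[leLHS](powRr0 x) ger_powR ?x0 ?ltW// subr_lt0.
by rewrite ler_expR lerN2 ltW.
Qed.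

Lemma eGammaE a : 0 < a < 1 -> eGamma a = (Gamma a)%:E.
Proof.
move=> a01; rewrite GammaE fineK// ge0_fin_numE ?eGamma_ge0//.
exact: eGamma_lty.
Qed.

Lemma Gamma_gt0 a : 0 < a < 1 -> 0 < Gamma a.
Proof. by move=> a01; rewrite -lte_fin -eGammaE// eGamma_gt0. Qed.

Lemma eBeta_Gamma a : 0 < a < 1 -> eBeta (1 - a) a = (Gamma (1 - a) * Gamma a)%:E.
Proof.
move=> /andP[a0 a1]; rewrite -eGamma_mulC1 ?subrK// !eGammaE ?EFinM//; apply/andP; lra.
Qed.

(** Both bases lie in ]0, 1[, so raising the exponents decreases the integrand. The comparison is
    with Beta(1 - a, a), a product of two finite Gamma values. *)
Lemma eBeta_lty a b c : 0 < a < 1 -> 1 - a <= c -> a <= b -> (eBeta c b < +oo)%E.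
Proof.
move=> a01 ac ab; apply: (@le_lt_trans _ _ (eBeta (1 - a) a)); last first.
  by rewrite eBeta_Gamma// ltry.
have mf (p q : R) : measurable_fun [set: R]
    (fun x => (tpow (p - 1) x * tpow (q - 1) (1 - x))%:E).
  apply/measurable_EFinP; apply: measurable_funM; apply: measurable_tpow_comp => //.
  exact: measurable_funB.
apply: ge0_le_integral => //; [|exact: mf|exact: mf|].
- by move=> x _; rewrite lee_fin mulr_ge0 ?tpow_ge0.
move=> x _; rewrite lee_fin.
have [x0|x0] := leP x 0; first by rewrite !(le0_tpow _ x0) !mul0r.
have [x1|x1] := leP (1 - x) 0; first by rewrite !(le0_tpow _ x1) !mulr0.
rewrite !gt0_tpow//; apply: ler_pM; rewrite ?powR_ge0// ger_powR ?x0 ?x1 ?lerD2r//; lra.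
Qed.

End Gamma_facts.

(** * Alikhanov's inequality *)

Section time_calculus.
Context {R : realType}.
Local Notation mu := (@lebesgue_measure R).
Implicit Types (a b r t : R) (f F phi : R -> R).

(* The primitive of phi is continuous up to the endpoints because phi is
   integrable, so F minus this primitive is nondecreasing on [a, b]. *)
Lemma Rintegral_le_derive1 a b F phi : a < b ->
  {within `[a, b], continuous F} ->
  mu.-integrable `]a, b[ (EFin \o phi) ->
  {in `]a, b[, continuous phi} ->
  (forall s, s \in `]a, b[ -> derivable F s 1) ->
  (forall s, s \in `]a, b[ -> phi s <= derive1 F s) ->
  \int[mu]_(s in `]a, b[) phi s <= F b - F a.
Proof.
move=> ab cF iphi cphi dF phiF'.
pose g := phi \_ `]a, b[.
have ig : mu.-integrable `[a, b] (EFin \o g).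
  rewrite -restrict_EFin; apply/integrable_restrict => //=.
  by rewrite setIidr//; exact: subset_itv_oo_cc.
have -> : \int[mu]_(s in `]a, b[) phi s = \int[mu]_(s in `[a, b]) g s.
  by rewrite -Rintegral_mkcondr setIidr//; exact: subset_itv_oo_cc.
pose G x := F x - \int[mu]_(s in `[a, x]) g s.
have dg x : x \in `]a, b[ -> derivable (fun x => \int[mu]_(s in `[a, x]) g s) x 1 /\
    derive1 (fun x => \int[mu]_(s in `[a, x]) g s) x = phi x.
  move=> xab; have /andP[ax xb] : a < x < b by move: xab; rewrite in_itv.
  have gx : g x = phi x by rewrite /g patchE mem_set.
  rewrite -gx; apply: (continuous_FTC1_closed xb ig ax).
  suff : g y @[y --> x] --> phi x by rewrite -gx.
  apply: cvg_trans (cphi x xab); apply: near_eq_cvg.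
  near=> y; rewrite /g patchE mem_set//.
  near: y; exact: near_in_itvoo.
have dG x : x \in `]a, b[ -> derivable G x 1.
  by move=> xab; apply: derivableB; [exact: dF|exact: (dg x xab).1].
have G'0 x : x \in `]a, b[ -> 0 <= derive1 G x.
  move=> xab; rewrite derive1E deriveB; [|exact: dF|exact: (dg x xab).1].
  by rewrite -!derive1E (dg x xab).2 subr_ge0 phiF'.
have cG : {within `[a, b], continuous G}.
  apply/subspace_continuousP => x xab; apply: cvgB.
    by move/subspace_continuousP : cF; exact.
  by have /subspace_continuousP := parameterized_integral_continuous (ltW ab) ig; exact.
have aab : a \in `[a, b] by rewrite in_itv/= lexx ltW.
have bab : b \in `[a, b] by rewrite in_itv/= lexx ltW.
have := ger0_derive1_le_cc dG G'0 cG aab bab (ltW ab).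
rewrite /G set_itv1 Rintegral_set1 subr0; lra.
Unshelve. all: by end_near. Qed.


Lemma dnbhs_shift (x : R) : x^' = (fun h => h + x) @ 0^'.
Proof.
apply/seteqP; split => P [e /= e0 Pe]; exists e => //= y ye y0.
- apply: Pe; last by rewrite -subr_eq0 addrK.
  by move: ye; rewrite /= sub0r normrN opprD addrCA subrr addr0 normrN.
- rewrite -(subrK x y); apply: (Pe (y - x)); last by rewrite subr_eq0.
  by move: ye; rewrite /= sub0r opprB.
Qed.

(** Links the quotient in y that underlies [derive_within] to the increment form in h that underlies
    [derivable] and ['D_1]. *)
Lemma quotient_cvgP f (x l : R) :
  (fun y => (f y - f x) / (y - x)) @ x^' --> l <->
  h^-1 *: (f (h *: 1 + x) - f x) @[h --> 0^'] --> l.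
Proof.
rewrite dnbhs_shift -fmap_comp.
rewrite (_ : _ \o _ = fun h => h^-1 *: (f (h *: 1 + x) - f x))//.
by apply/funext => h; rewrite /= addrK mulrC /GRing.scale/= mulr1.
Qed.

Lemma is_derive_powRBl r p (s : R) : s < r ->
  is_derive s 1 (fun s => (r - s) `^ p) (- (p * (r - s) `^ (p - 1))).
Proof.
move=> sr; have rs0 : 0 < r - s by rewrite subr_gt0.
have d1 := is_derive1_powR p rs0.
have d2 : is_derive s 1 (fun s : R => r - s) (0 - 1).
  exact: (is_deriveB (is_derive_cst r s 1) (is_derive_id s 1)).
by have := is_derive1_comp (g := fun s : R => r - s) d1 d2; rewrite sub0r mulrN1.
Qed.

Lemma at_left_subl r : (fun s : R => r - s) @ r^'- --> (0 : R)^'+.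
Proof.
move=> P [e /= e0 Pe]; exists e => //= s sr rs; apply: Pe; last by rewrite /= subr_gt0.
by rewrite /= sub0r normrN.
Qed.

Lemma powR_sub_cvg0 r p : 0 < p -> (r - s) `^ p @[s --> r^'-] --> (0 : R).
Proof.
by move=> p0; exact: (cvg_comp (fun s => r - s) (@powR R ^~ p) (@at_left_subl r) (powR_cvg0 p0)).
Qed.

Lemma continuous_powRBl r p (s : R) : s < r -> {for s, continuous (fun s => (r - s) `^ p)}.
Proof.
move=> sr; apply: differentiable_continuous; apply/derivable1_diffP.
by have [] := is_derive_powRBl p sr.
Qed.

Lemma within_continuous_bounded f a b : {within `[a, b], continuous f} ->
  exists M, forall x, x \in `[a, b] -> `|f x| <= M.
Proof.
move=> cf; have := continuous_compact cf (@segment_compact _ a b).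
move=> /compact_bounded [M [_ /(_ (`|M| + 1))]] => bM.
exists (`|M| + 1) => x xab; apply: bM; last by exists x.
by rewrite (le_lt_trans (ler_norm _))// ltrDl.
Qed.

Lemma bounded_integrableM a b f (g : R -> R) : {within `[a, b], continuous f} ->
  mu.-integrable `]a, b[ (EFin \o g) ->
  mu.-integrable `]a, b[ (EFin \o (fun x => f x * g x)).
Proof.
move=> cf ig.
have mf : measurable_fun `]a, b[ f.
  apply: (@measurable_funS _ _ _ _ `[a, b]%classic) => //.
    exact: subset_itv_oo_cc.
  exact: subspace_continuous_measurable_fun.
have [M fM] := within_continuous_bounded cf.
have bf : [bounded f x | x in `]a, b[%classic].
  exists `|M|; split; first exact: num_real.
  move=> y My x xab; apply: (le_trans (fM x _)); last exact: ltW (le_lt_trans (ler_norm M) My).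
  exact: subset_itv_oo_cc xab.
have H : mu.-integrable `]a, b[ ((EFin \o f) \* (EFin \o g))%E by exact: integrableMr.
exact: H.
Qed.

Lemma integrableRZl (D : set R) k (g : R -> R) : measurable D ->
  mu.-integrable D (EFin \o g) -> mu.-integrable D (EFin \o (fun x => k * g x)).
Proof.
move=> mD ig.
have H : mu.-integrable D (fun x => (k%:E * (EFin \o g) x)%E) by exact: integrableZl.
exact: H.
Qed.

Lemma integrableRD (D : set R) (g h : R -> R) : measurable D ->
  mu.-integrable D (EFin \o g) -> mu.-integrable D (EFin \o h) ->
  mu.-integrable D (EFin \o (fun x => g x + h x)).
Proof.
move=> mD ig ih.
have H : mu.-integrable D ((EFin \o g) \+ (EFin \o h))%E by exact: integrableD.
exact: H.
Qed.

Lemma integrableRB (D : set R) (g h : R -> R) : measurable D ->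
  mu.-integrable D (EFin \o g) -> mu.-integrable D (EFin \o h) ->
  mu.-integrable D (EFin \o (fun x => g x - h x)).
Proof.
move=> mD ig ih.
have H : mu.-integrable D ((EFin \o g) \- (EFin \o h))%E by exact: integrableB.
exact: H.
Qed.

(** With K the Caputo kernel, the derivative of F s = (r - s)^(-alpha) (f s - f r)^2 is a
    nonnegative term plus 2 (f s - f r) K s. Hence the integral of the latter is at most F r - F 0,
    which is nonpositive since F r = 0. Derivability of f at r itself is what makes F continuous
    there. *)
Lemma alikhanov alpha f r : 0 < alpha < 1 -> 0 < r ->
  {within `[0, r], continuous f} ->
  (forall s, s \in `]0, r[ -> derivable f s 1) ->
  derivable f r 1 ->
  {in `]0, r[, continuous (derive1 f)} ->
  mu.-integrable `]0, r[ (EFin \o caputo_kernel alpha f r) ->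
  \int[mu]_(s in `]0, r[) (2 * f s * caputo_kernel alpha f r s) <=
  2 * f r * \int[mu]_(s in `]0, r[) caputo_kernel alpha f r s.
Proof.
move=> /andP[al0 al1] r0 cf df dfr cf' iK.
set K := caputo_kernel alpha f r.
have ifK : mu.-integrable `]0, r[ (EFin \o (fun s => f s * K s)).
  exact: bounded_integrableM.
have i2fK : mu.-integrable `]0, r[ (EFin \o (fun s => 2 * f s * K s)).
  rewrite (_ : (fun s => _) = (fun s => 2 * (f s * K s))).
    exact: integrableRZl.
  by apply/funext => s; rewrite mulrA.
have i2fr : mu.-integrable `]0, r[ (EFin \o (fun s => 2 * f r * K s)).
  exact: integrableRZl.
rewrite -RintegralZl// -subr_le0 -RintegralB//.
pose F s := (r - s) `^ (- alpha) * (f s - f r) ^+ 2.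
have cfi s : s \in `]0, r[ -> {for s, continuous f}.
  by move=> sr; apply: differentiable_continuous; apply/derivable1_diffP/df.
have cK s : s \in `]0, r[ -> {for s, continuous K}.
  move=> sr; have slr : s < r by move: sr; rewrite in_itv => /andP[].
  apply: continuousM; first exact: cf'.
  apply: continuousV; last exact: continuous_powRBl.
  by rewrite gt_eqF// powR_gt0// subr_gt0.
have dF s : s \in `]0, r[ -> is_derive s 1 F
   (alpha * (r - s) `^ (- alpha - 1) * (f s - f r) ^+ 2 +
    2 * (f s - f r) * K s).
  move=> sr; have slr : s < r by move: sr; rewrite in_itv => /andP[].
  have d1 := is_derive_powRBl (- alpha) slr.
  have d2 : is_derive s 1 f (derive1 f s).
    by rewrite derive1E; apply: derivableP; exact: df.
  have d3 : is_derive s 1 (fun s => f s - f r) (derive1 f s - 0).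
    exact: (is_deriveB d2 (is_derive_cst (f r) s 1)).
  apply: (is_derive_eq (is_deriveM d1 (is_deriveX 2 d3))).
  rewrite /K /caputo_kernel /GRing.scale /= powRN expr1 exprfctE; ring.
have F0 : F r - F 0 <= 0.
  by rewrite /F !subrr expr0n/= mulr0 sub0r oppr_le0 mulr_ge0 ?powR_ge0 ?sqr_ge0.
apply: le_trans F0.
apply: (Rintegral_le_derive1 r0).
- apply/continuous_within_itvP => //.
  have [_ cf0 _] := (continuous_within_itvP f r0).1 cf.
  split.
  + move=> s sr; apply: differentiable_continuous; apply/derivable1_diffP.
    by have [] := dF s sr.
  + apply: cvgM.
      by apply: cvg_at_right_filter; exact: continuous_powRBl.
    by apply: cvgM; apply: cvgB => //; exact: cvg_cst.
  (* Near r, F is (r - s)^(2 - alpha) times the square of a difference quotient that converges to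
     the derivative of f at r; the exponent is positive, so F tends to 0. *)
  + rewrite {2}/F !subrr expr0n/= mulr0.
    have q : (f s - f r) / (s - r) @[s --> r^'-] --> 'D_1 f r.
      by apply: cvg_dnbhs_at_left; apply/quotient_cvgP.
    have : (r - s) `^ (2 - alpha) * ((f s - f r) / (s - r)) ^+ 2 @[s --> r^'-] -->
        0 * ('D_1 f r) ^+ 2.
      apply: cvgM; last by apply: cvgM.
      by apply: powR_sub_cvg0; lra.
    rewrite mul0r; apply: cvg_trans; apply: near_eq_cvg.
    near=> s.
    have sr : s < r by [].
    have rs0 : 0 < r - s by rewrite subr_gt0.
    rewrite /F powRD ?(gt_eqF rs0) ?implybT//.
    rewrite [_ `^ 2](@powR_mulrn _ _ 2) ?ltW//.
    have : s - r != 0 by rewrite subr_eq0 lt_eqF.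
    by move=> ?; field.
- exact: integrableRB.
- move=> s sr; apply: cvgB; apply: cvgM; [|exact: cK|exact: cvg_cst|exact: cK].
  by apply: cvgM; [exact: cvg_cst|exact: cfi].
- by move=> s sr; have [] := dF s sr.
- move=> s sr; rewrite derive1E; have [_ ->] := dF s sr.
  rewrite [leRHS](_ : _ = alpha * (r - s) `^ (- alpha - 1) * (f s - f r) ^+ 2 +
    (2 * f s * K s - 2 * f r * K s)); last by ring.
  by rewrite lerDr; apply: mulr_ge0; rewrite ?sqr_ge0 ?mulr_ge0 ?powR_ge0 ?ltW.
Unshelve. all: by end_near. Qed.

End time_calculus.

(** * Composing fractional integrals with Caputo derivatives *)

Section fractional_composition.
Context {R : realType}.
Local Notation mu := (@lebesgue_measure R).
Implicit Types (alpha beta gamma r s t : R) (f : R -> R).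

Lemma powR_sub_cvg r beta : 0 <= beta -> (r - s) `^ beta @[s --> r^'-] --> 0 `^ beta.
Proof.
rewrite le_eqVlt => /predU1P[<-|b0]; last by rewrite powR0 ?gt_eqF//; exact: powR_sub_cvg0.
by rewrite powRr0; under eq_fun do rewrite powRr0; exact: cvg_cst.
Qed.

Lemma within_continuous_powR_sub t beta : 0 < t -> 0 <= beta ->
  {within `[0, t], continuous (fun s => (t - s) `^ beta)}.
Proof.
move=> t0 b0; apply/continuous_within_itvP => //; split.
- by move=> s; rewrite in_itv/= => /andP[_ st]; exact: continuous_powRBl.
- by apply: cvg_at_right_filter; exact: continuous_powRBl.
- by rewrite subrr; exact: powR_sub_cvg.
Qed.

(* The boundary term at s = t survives only for beta = 0, where 0 `^ 0 = 1. *)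
Lemma weighted_sqr_derive1_ge t beta f : 0 < t -> 0 <= beta ->
  {within `[0, t], continuous f} ->
  (forall s, s \in `]0, t[ -> derivable f s 1) ->
  {in `]0, t[, continuous (derive1 f)} ->
  mu.-integrable `]0, t[ (EFin \o derive1 f) ->
  0 `^ beta * f t ^+ 2 - t `^ beta * f 0 ^+ 2 <=
  \int[mu]_(s in `]0, t[) ((t - s) `^ beta * (2 * f s * derive1 f s)).
Proof.
move=> t0 b0 cf df cf' if'.
have cw := within_continuous_powR_sub t0 b0.
have i1 : mu.-integrable `]0, t[ (EFin \o (fun s => 2 * f s * derive1 f s)).
  rewrite (_ : (fun s => _) = (fun s => 2 * (f s * derive1 f s))); last first.
    by apply/funext => s; rewrite mulrA.
  by apply: integrableRZl => //; exact: bounded_integrableM.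
have i2 := bounded_integrableM cw i1.
rewrite -lerN2 opprB -mulN1r -RintegralZl//.
pose F s := - ((t - s) `^ beta * f s ^+ 2).
have -> : t `^ beta * f 0 ^+ 2 - 0 `^ beta * f t ^+ 2 = F t - F 0.
  by rewrite /F subrr subr0; ring.
have dF s : s \in `]0, t[ -> is_derive s 1 F
   (beta * (t - s) `^ (beta - 1) * f s ^+ 2 +
    -1 * ((t - s) `^ beta * (2 * f s * derive1 f s))).
  move=> st; have slt : s < t by move: st; rewrite in_itv => /andP[].
  have d1 := is_derive_powRBl beta slt.
  have d2 : is_derive s 1 f (derive1 f s).
    by rewrite derive1E; apply: derivableP; exact: df.
  apply: (is_derive_eq (is_deriveN (is_deriveM d1 (is_deriveX 2 d2)))).
  by rewrite /GRing.scale /= expr1 exprfctE; ring.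
apply: (Rintegral_le_derive1 t0).
- apply/continuous_within_itvP => //.
  have [_ cf0 cft] := (continuous_within_itvP f t0).1 cf.
  have [_ cw0 cwt] := (continuous_within_itvP _ t0).1 cw.
  split.
  + move=> s sr; apply: differentiable_continuous; apply/derivable1_diffP.
    by have [] := dF s sr.
  + by apply: cvgN; apply: cvgM => //; apply: cvgM.
  + by apply: cvgN; apply: cvgM => //; apply: cvgM.
- exact: integrableRZl.
- move=> s st; have slt : s < t by move: st; rewrite in_itv => /andP[].
  apply: cvgM; first exact: cvg_cst.
  apply: cvgM; first exact: continuous_powRBl.
  apply: cvgM; last exact: cf'.
  apply: cvgM; first exact: cvg_cst.
  by apply: differentiable_continuous; apply/derivable1_diffP/df.
- by move=> s sr; have [] := dF s sr.
- move=> s sr; rewrite [leRHS]derive1E; have [_ ->] := dF s sr.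
  by rewrite lerDr; apply: mulr_ge0; rewrite ?sqr_ge0 ?mulr_ge0 ?powR_ge0.
Qed.

Lemma integral_tpow_convZ a b s t (c : R) : s < t -> (eBeta a b < +oo)%E ->
  (\int[mu]_r (tpow (a - 1) (r - s) * tpow (b - 1) (t - r) * c)%:E =
   ((t - s) `^ (a + b - 1) * fine (eBeta a b) * c)%:E)%E.
Proof.
move=> st Blty.
have Bfin : eBeta a b = (fine (eBeta a b))%:E.
  by rewrite fineK// ge0_fin_numE ?eBeta_ge0.
have H := integral_tpow_conv a b st; rewrite Bfin -EFinM in H.
have mk : measurable_fun [set: R] (fun r => (tpow (a - 1) (r - s) * tpow (b - 1) (t - r))%:E).
  apply/measurable_EFinP; apply: measurable_funM; apply: measurable_tpow_comp;
    exact: measurable_funB.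
have ik : mu.-integrable [set: R] (fun r => (tpow (a - 1) (r - s) * tpow (b - 1) (t - r))%:E).
  apply/integrableP; split => //.
  under eq_integral => r _ do rewrite gee0_abs ?lee_fin ?mulr_ge0 ?tpow_ge0//.
  by rewrite H ltry.
under eq_integral do rewrite EFinM.
by rewrite integralZr// H -EFinM.
Qed.

(** Fubini on the triangle 0 < s < r < t for the product of (r - s)^(-alpha), (t - r)^(gamma - 1)
    and (f^2)' s. Integrating over r gives the Beta constant times (t - s)^(gamma - alpha), a
    bounded weight because alpha <= gamma. Integrating over s gives Gamma (1 - alpha) times the
    Caputo derivative of f^2 at r, which Alikhanov's inequality bounds pointwise. *)
Lemma RL_caputo_ge alpha gamma t f : 0 < alpha -> alpha <= gamma -> gamma < 1 ->
  0 < t ->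
  {within `[0, t], continuous f} ->
  (forall s, s \in `]0, t[ -> derivable f s 1) ->
  {in `]0, t[, continuous (derive1 f)} ->
  mu.-integrable `]0, t[ (EFin \o derive1 f) ->
  (forall r, r \in `]0, t[ -> mu.-integrable `]0, r[ (EFin \o caputo_kernel alpha f r)) ->
  mu.-integrable `]0, t[
    (EFin \o (fun r => (t - r) `^ (gamma - 1) * (f r * caputo alpha f r))) ->
  fine (eBeta (1 - alpha) gamma) *
    \int[mu]_(s in `]0, t[) ((t - s) `^ (gamma - alpha) * (2 * f s * derive1 f s))
  <= 2 * Gamma (1 - alpha) *
    \int[mu]_(r in `]0, t[) ((t - r) `^ (gamma - 1) * (f r * caputo alpha f r)).
Proof.
move=> al0 alg g1 t0 cf df cf' if' iK iH.
have Blty : (eBeta (1 - alpha) gamma < +oo)%E by apply: (@eBeta_lty _ alpha) => //; apply/andP; lra.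
have B0 : 0 <= fine (eBeta (1 - alpha) gamma) by rewrite fine_ge0 ?eBeta_ge0.
set B := fine _ in B0 *.
pose psi s := 2 * f s * derive1 f s.
have ipsi : mu.-integrable `]0, t[ (EFin \o psi).
  rewrite /psi (_ : (fun s => _) = (fun s => 2 * (f s * derive1 f s))); last first.
    by apply/funext => s; rewrite mulrA.
  by apply: integrableRZl => //; exact: bounded_integrableM.
have mpsi : measurable_fun [set: R] (psi \_ `]0, t[).
  apply/(measurable_restrictT _ _).1 => //.
  by apply/measurable_EFinP; exact: measurable_int ipsi.
pose J s := (t - s) `^ (gamma - alpha) * psi s.
have iJ : mu.-integrable `]0, t[ (EFin \o J).
  by apply: bounded_integrableM => //; apply: within_continuous_powR_sub => //; lra.
(* Here z = (r, s); the truncated powers and the restriction of [psi] confine [k] to the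
   triangle. *)
pose k (z : R * R) : \bar R :=
  (tpow ((1 - alpha) - 1) (z.1 - z.2) * tpow (gamma - 1) (t - z.1) *
   (psi \_ `]0, t[) z.2)%:E.
have mk : measurable_fun [set: R * R] k.
  apply/measurable_EFinP; apply: measurable_funM; last exact: measurableT_comp.
  by apply: measurable_funM; apply: measurable_tpow_comp; apply: measurable_funB.
(* Used twice: with c the absolute value, for integrability on the plane, and with c the identity,
   for the value of the iterated integral. *)
have kin (c : R -> R) s : (\int[mu]_r (tpow ((1 - alpha) - 1) (r - s) *
    tpow (gamma - 1) (t - r) * c ((psi \_ `]0, t[) s))%:E =
    (if (s \in `]0, t[)%R then ((t - s) `^ (gamma - alpha) * B * c (psi s))%:E
     else \int[mu]_r (tpow ((1 - alpha) - 1) (r - s) * tpow (gamma - 1) (t - r) * c 0%R)%:E))%E.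
  rewrite patchE mem_setE; case: ifPn => // st.
  have slt : s < t by move: st; rewrite in_itv => /andP[].
  rewrite integral_tpow_convZ//; congr ((_ `^ _ * _ * _)%:E); lra.
have ik : (mu \x mu)%E.-integrable [set: R * R] k.
  apply/integrable21ltyP => //.
  have -> : (\int[mu]_s \int[mu]_r `|k (r, s)| =
      \int[mu]_(s in `]0%R, t[) `|(B * J s)%:E|)%E.
    rewrite [RHS]integral_mkcond; apply: eq_integral => s _.
    under eq_integral => r _.
      rewrite /k /= normrM ger0_norm ?mulr_ge0 ?tpow_ge0//; over.
    rewrite (kin Num.norm) patchE mem_setE; case: ifPn => // st.
      congr EFin; rewrite /J !normrM (ger0_norm B0) (ger0_norm (powR_ge0 _ _)); ring.
    by apply: integral0_eq => r _; rewrite normr0 mulr0.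
  by have /integrableP[] := @integrableRZl _ _ B J (measurable_itv `]0, t[) iJ.
have EF : (\int[mu]_s \int[mu]_r k (r, s) = (B * \int[mu]_(s in `]0%R, t[) J s)%:E)%E.
  rewrite -RintegralZl// /Rintegral fineK; last first.
    by apply: integrable_fin_num => //; exact: integrableRZl.
  rewrite [RHS]integral_mkcond; apply: eq_integral => s _.
  rewrite (kin id) patchE mem_setE; case: ifPn => // st.
    by congr EFin; rewrite /J; ring.
  by apply: integral0_eq => r _; rewrite mulr0.
pose L r := (t - r) `^ (gamma - 1) * \int[mu]_(s in `]0, r[) (2 * f s * caputo_kernel alpha f r s).
have sub r : r \in `]0, t[ -> [/\ 0 < r, r < t & forall s, s \in `]0, r[ -> s \in `]0, t[].
  rewrite in_itv/= => /andP[r0 rt]; split => // s; rewrite !in_itv/= => /andP[-> sr].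
  exact: lt_trans sr rt.
have cfr r : r \in `]0, t[ -> {within `[0, r], continuous f}.
  move=> /sub[r0 rt _]; apply: continuous_subspaceW cf.
  by apply: subset_itvl; rewrite bnd_simp ltW.
have EG r : (\int[mu]_s k (r, s) = ((L \_ `]0, t[) r)%:E)%E.
  rewrite patchE mem_setE; case: ifPn => rt; last first.
    apply: integral0_eq => s _; rewrite /k /= patchE mem_setE; case: ifPn => st.
      have {rt}[r0|r0] : r <= 0 \/ t <= r.
        by move: rt; rewrite in_itv/= negb_and -!leNgt => /orP[]; [left|right].
      - rewrite [tpow _ (r - s)]le0_tpow ?mul0r// subr_le0 (le_trans r0)//.
        by move: st; rewrite in_itv/= => /andP[/ltW].
      - by rewrite [tpow _ (t - r)]le0_tpow ?mulr0 ?mul0r// subr_le0.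
    by rewrite mulr0.
  have [r0 rlt srt] := sub _ rt.
  have i1 : mu.-integrable `]0, r[ (EFin \o (fun s => 2 * f s * caputo_kernel alpha f r s)).
    rewrite (_ : (fun s => _) = (fun s => 2 * (f s * caputo_kernel alpha f r s))); last first.
      by apply/funext => s; rewrite mulrA.
    by apply: integrableRZl => //; apply: bounded_integrableM; [exact: cfr|exact: iK].
  rewrite /L -RintegralZl// /Rintegral fineK; last first.
    by apply: integrable_fin_num => //; exact: integrableRZl.
  rewrite [RHS]integral_mkcond; apply: eq_integral => s _.
  rewrite /k /= !patchE !mem_setE; case: ifPn => st; case: ifPn => sr.
  - move: sr; rewrite in_itv/= => /andP[s0 sr].
    rewrite !gt0_tpow ?subr_gt0// /caputo_kernel -powRN addrAC subrr sub0r /psi.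
    by congr EFin; ring.
  - rewrite [tpow _ (r - s)]le0_tpow ?mul0r// subr_le0 leNgt.
    by apply: contra sr => sr; move: st; rewrite !in_itv/= sr => /andP[->].
  - by rewrite srt in st.
  - by rewrite mulr0.
have EGi : (\int[mu]_r \int[mu]_s k (r, s))%E = (\int[mu]_(r in `]0%R, t[) (L r)%:E)%E.
  rewrite [RHS]integral_mkcond; apply: eq_integral => r _; rewrite EG.
  by rewrite !patchE; case: ifP.
have iL : mu.-integrable `]0, t[ (EFin \o L).
  rewrite integrable_mkcond//.
  have := integrable_fubini_F ik; rewrite /fubini_F.
  rewrite (_ : (fun x => _) = (EFin \o L) \_ `]0, t[)//.
  by apply/funext => r; rewrite EG !patchE; case: ifP.
have -> : B * \int[mu]_(s in `]0, t[) J s = \int[mu]_(r in `]0, t[) L r.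
  by rewrite [RHS]/Rintegral -EGi (Fubini ik) EF.
rewrite -RintegralZl//.
apply: le_Rintegral => //; first exact: integrableRZl.
move=> r rt; have [r0 rlt srt] := sub _ rt.
rewrite /L mulrCA; apply: ler_wpM2l; first exact: powR_ge0.
have G0 : 0 < Gamma (1 - alpha) by apply: Gamma_gt0; apply/andP; lra.
have -> : 2 * Gamma (1 - alpha) * (f r * caputo alpha f r) =
    2 * f r * \int[mu]_(s in `]0, r[) caputo_kernel alpha f r s.
  by rewrite /caputo; field; rewrite gt_eqF.
apply: alikhanov => //.
- by apply/andP; lra.
- exact: cfr.
- by move=> s /srt; exact: df.
- exact: df.
- by move=> s /srt; exact: cf'.
- exact: iK.
Qed.

End fractional_composition.

(** * Energy inequalities in time: order gamma in the interior, a lower order at the endpoints *)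

Section fractional_energy.
Context {R : realType}.
Local Notation mu := (@lebesgue_measure R).
Implicit Types (alpha gamma r s t : R) (f : R -> R).

(** The derivative may be unbounded near time 0; its integrability there replaces continuity up to
    0. *)
Definition caputo_regular f t : Prop :=
  [/\ {within `[0, t], continuous f},
      forall s, s \in `]0, t[ -> derivable f s 1,
      {in `]0, t[, continuous (derive1 f)} &
      mu.-integrable `]0, t[ (EFin \o derive1 f)].

(** The case alpha = gamma: the weight is (t - s)^0 = 1, so both boundary values keep coefficient 1,
    and Gamma (1 - gamma) cancels from the Beta constant. *)
Lemma RL_caputo_sqr_ge gamma t f : 0 < gamma < 1 -> 0 < t -> caputo_regular f t ->
  (forall r, r \in `]0, t[ -> mu.-integrable `]0, r[ (EFin \o caputo_kernel gamma f r)) ->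
  mu.-integrable `]0, t[
    (EFin \o (fun r => (t - r) `^ (gamma - 1) * (f r * caputo gamma f r))) ->
  Gamma gamma * (f t ^+ 2 - f 0 ^+ 2) <=
    2 * \int[mu]_(r in `]0, t[) ((t - r) `^ (gamma - 1) * (f r * caputo gamma f r)).
Proof.
move=> /andP[g0 g1] t0 [cf df cf' if'] iK iH.
have g01 : 0 < gamma < 1 by apply/andP.
have G0 : 0 < Gamma (1 - gamma) by apply: Gamma_gt0; apply/andP; lra.
have := RL_caputo_ge g0 (lexx gamma) g1 t0 cf df cf' if' iK iH.
rewrite eBeta_Gamma//= subrr => H.
have W := weighted_sqr_derive1_ge t0 (lexx 0) cf df cf' if'.
rewrite !powRr0 !mul1r in W.
rewrite -(ler_pM2l G0) mulrA; apply: (le_trans _ (le_trans H _)); last first.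
  by rewrite mulrA (mulrC 2).
exact: ler_wpM2l (ltW (mulr_gt0 G0 (Gamma_gt0 g01))) _ _ W.
Qed.

(** The weight (t - s)^(gamma - alpha) vanishes at s = t, and f 0 = 0 removes the boundary term at s
    = 0, so the lower bound is 0. *)
Lemma RL_caputo_sqr_ge0 alpha gamma t f : 0 < alpha -> alpha < gamma -> gamma < 1 ->
  0 < t -> caputo_regular f t -> f 0 = 0 ->
  (forall r, r \in `]0, t[ -> mu.-integrable `]0, r[ (EFin \o caputo_kernel alpha f r)) ->
  mu.-integrable `]0, t[
    (EFin \o (fun r => (t - r) `^ (gamma - 1) * (f r * caputo alpha f r))) ->
  0 <= \int[mu]_(r in `]0, t[) ((t - r) `^ (gamma - 1) * (f r * caputo alpha f r)).
Proof.
move=> al0 alg g1 t0 [cf df cf' if'] f0 iK iH.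
have G0 : 0 < Gamma (1 - alpha) by apply: Gamma_gt0; apply/andP; lra.
rewrite -(pmulr_rge0 _ (mulr_gt0 (@ltr0Sn R 1) G0)).
apply: le_trans (RL_caputo_ge al0 (ltW alg) g1 t0 cf df cf' if' iK iH).
apply: mulr_ge0; first by rewrite fine_ge0 ?eBeta_ge0.
have b0 : 0 < gamma - alpha by rewrite subr_gt0.
apply: le_trans (weighted_sqr_derive1_ge t0 (ltW b0) cf df cf' if').
by rewrite f0 powR0 ?gt_eqF// mul0r expr0n/= mulr0 subr0.
Qed.

(** The integral of the kernel is a Beta convolution whose other exponent is 1, that is, with the
    factor r^0 = 1. *)
Lemma integrable_RL_kernel gamma t : 0 < gamma < 1 -> 0 < t ->
  mu.-integrable `]0, t[ (EFin \o (fun r => (t - r) `^ (gamma - 1))).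
Proof.
move=> g01 t0.
have Blty : (eBeta 1 gamma < +oo)%E.
  by apply: (@eBeta_lty _ gamma) => //; rewrite lerBlDr lerDl ltW//; case/andP: g01.
have H := integral_tpow_convZ 1 t0 Blty.
apply/integrableP; split.
  apply/measurable_EFinP; apply: measurable_funTS.
  by apply: (measurableT_comp (measurable_powR _)); exact: measurable_funB.
have -> : (\int[mu]_(r in `]0%R, t[) `|(EFin \o (fun r => ((t - r) `^ (gamma - 1))%R)) r| =
    \int[mu]_r (tpow (1 - 1) (r - 0) * tpow (gamma - 1) (t - r) * 1)%:E)%E.
  rewrite integral_mkcond; apply: eq_integral => r _.
  rewrite patchE mem_setE in_itv/= mulr1 subr0; case: ifPn.
    move=> /andP[r0 rt]; rewrite !gt0_tpow ?subr_gt0// subrr powRr0 mul1r.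
    by rewrite ger0_norm ?powR_ge0.
  rewrite negb_and -!leNgt => /orP[r0|r0]; first by rewrite (le0_tpow _ r0) mul0r.
  by rewrite [tpow _ (t - r)]le0_tpow ?mulr0// subr_le0.
by rewrite H ltry.
Qed.

End fractional_energy.

(** * Measurability of continuous functions on the plane *)

Section space_time_integral.
Context {R : realType}.
Local Notation mu := (@lebesgue_measure R).

(** The product sigma-algebra contains the open boxes, and an open set is the union of the countably
    many boxes with rational centre and radius 1/(n + 1) that it contains. *)
Lemma open2_measurable (U : set (R * R)) : open U -> measurable U.
Proof.
move=> oU.
pose box (i : rat * rat * nat) : set (R * R) :=
  ball (ratr i.1.1 : R) (i.2.+1%:R^-1) `*` ball (ratr i.1.2 : R) (i.2.+1%:R^-1).
have -> : U = \bigcup_i (if `[< box i `<=` U >] then box i else set0).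
  apply/seteqP; split => [[x y] Uxy|z [i _]]; last by case: asboolP => // iU /iU.
  have [[A B] /= [[e1 /= e10 xA] [e2 /= e20 yB]] ABU] := open_nbhs_nbhs (conj oU Uxy).
  pose e := Num.min e1 e2.
  have e0 : 0 < e by rewrite /e lt_min e10.
  (* The rational centre is within 1/(n + 1) of the given point, and so is every point of the box
     from the centre; half of e leaves room for both distances. *)
  have [n _ ne] := near_infty_natSinv_lt (PosNum (divr_gt0 e0 (ltr0Sn R 1))).
  have {}ne : n.+1%:R^-1 < e / 2 := ne n (leqnn n).
  have n0 : 0 < n.+1%:R^-1 :> R by rewrite invr_gt0.
  have e_1 : e <= e1 by rewrite ge_min lexx.
  have e_2 : e <= e2 by rewrite ge_min lexx orbT.
  have rat_near (z : R) : exists q : rat, `|ratr q - z| < n.+1%:R^-1.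
    have [|q] := @rat_in_itvoo R (z - n.+1%:R^-1) (z + n.+1%:R^-1).
      by rewrite ltrD2l gtrN.
    by rewrite in_itv/= -ltr_distl => zq; exists q.
  have [p xp] := rat_near x; have [q yq] := rat_near y.
  have ball_sub (z z' : R) (c : rat) : `|ratr c - z| < n.+1%:R^-1 ->
      ball (ratr c : R) (n.+1%:R^-1) z' -> `|z - z'| < e.
    move=> zc; rewrite /ball/= => cz'.
    rewrite -(subrK (ratr c) z) -addrA (le_lt_trans (ler_normD _ _))//.
    rewrite [ltRHS]splitr; apply: ltrD; last exact: lt_trans cz' ne.
    by rewrite distrC; exact: lt_trans zc ne.
  have sub : box (p, q, n) `<=` U.
    move=> [x' y'] [/= bx bY]; apply: ABU; split => /=; [apply: xA|apply: yB].
      exact: lt_le_trans (ball_sub _ _ _ xp bx) e_1.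
    exact: lt_le_trans (ball_sub _ _ _ yq bY) e_2.
  by exists (p, q, n) => //; rewrite asboolT.
apply: countable_bigcupT_measurable; first exact: countableP.
by move=> i; case: asboolP => // _; apply: measurableX; exact: measurable_ball.
Qed.

Lemma continuous2_measurable_fun (G : R * R -> R) :
  continuous G -> measurable_fun [set: R * R] G.
Proof.
move=> /continuousP cG; apply: (measurability _ (RGenOpens.measurableE R)) => //.
move=> _ [_ [a [b ->] <-]]; rewrite setTI; apply: open2_measurable.
exact/cG/interval_open.
Qed.

End space_time_integral.

(** * Exchanging the space and time integrals *)

Section space_time_fubini.
Context {R : realType}.
Local Notation mu := (@lebesgue_measure R).
Implicit Types (G : R * R -> R).

Lemma continuous_section1 G (x : R) : continuous G -> continuous (fun r => G (x, r)).
Proof.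
move=> cG r; apply: (@continuous_comp _ _ _ (fun r => (x, r)) G); last exact: cG.
by apply: (@cvg_pair _ _ _ (nbhs r) (nbhs x) (nbhs r)); [exact: cvg_cst|exact: cvg_id].
Qed.

Lemma continuous_section2 G (r : R) : continuous G -> continuous (fun x => G (x, r)).
Proof.
move=> cG x; apply: (@continuous_comp _ _ _ (fun x => (x, r)) G); last exact: cG.
by apply: (@cvg_pair _ _ _ (nbhs x) (nbhs x) (nbhs r)); [exact: cvg_id|exact: cvg_cst].
Qed.

Lemma continuous_integrable_oo (a b : R) (f : R -> R) :
  {within `[a, b], continuous f} -> mu.-integrable `]a, b[ (EFin \o f).
Proof.
move=> cf; apply: (@integrableS _ _ _ mu `[a, b]%classic) => //.
  exact: subset_itv_oo_cc.
by apply: continuous_compact_integrable => //; exact: segment_compact.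
Qed.

Lemma continuous2_bounded G (a b c d : R) : continuous G ->
  exists2 M, 0 <= M & forall x r, x \in `[a, b] -> r \in `[c, d] -> `|G (x, r)| <= M.
Proof.
move=> cG.
have := @continuous_compact _ _ G (`[a, b] `*` `[c, d]) (continuous_subspaceT cG)
  (compact_setX (@segment_compact _ a b) (@segment_compact _ c d)).
move=> /compact_bounded [M [_ /(_ (`|M| + 1))]] => bM.
exists (`|M| + 1) => [|x r xab rcd]; first by rewrite addr_ge0.
apply: bM; last by exists (x, r).
by rewrite (le_lt_trans (ler_norm _))// ltrDl.
Qed.

(** P stands for the kernel, integrable but singular at t. G is bounded by some M on the compact
    rectangle, so M times the absolute value of P dominates the product. Continuity of G on the
    whole plane gives its joint measurability. *)
Lemma space_time_fubini (a b t : R) (P : R -> R) G : a < b ->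
  mu.-integrable `]0, t[ (EFin \o P) -> continuous G ->
  [/\ mu.-integrable `]a, b[ (EFin \o (fun x => \int[mu]_(r in `]0, t[) (P r * G (x, r)))),
      mu.-integrable `]0, t[ (EFin \o (fun r => P r * \int[mu]_(x in `]a, b[) G (x, r))) &
      \int[mu]_(x in `]a, b[) \int[mu]_(r in `]0, t[) (P r * G (x, r)) =
      \int[mu]_(r in `]0, t[) (P r * \int[mu]_(x in `]a, b[) G (x, r))].
Proof.
move=> ab iP cG.
have [M M0 GM] := continuous2_bounded a b 0 t cG.
pose Pt := P \_ `]0, t[.
have mPt : measurable_fun [set: R] Pt.
  apply/(measurable_restrictT _ _).1 => //.
  by apply/measurable_EFinP; exact: measurable_int iP.
pose k (z : R * R) : \bar R := (Pt z.2 * G z * \1_`]a, b[ z.1)%:E.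
have mk : measurable_fun [set: R * R] k.
  apply/measurable_EFinP; apply: measurable_funM; last first.
    exact: (measurableT_comp (measurable_indic _) measurable_fst).
  apply: measurable_funM; last exact: continuous2_measurable_fun.
  exact: (measurableT_comp mPt measurable_snd).
pose h (z : R * R) : \bar R := ((M * `|Pt z.2|) * \1_`]a, b[ z.1)%:E.
have mh : measurable_fun [set: R * R] h.
  apply/measurable_EFinP; apply: measurable_funM; last first.
    exact: (measurableT_comp (measurable_indic _) measurable_fst).
  apply: measurable_funM => //; apply: measurableT_comp => //.
  exact: (measurableT_comp mPt measurable_snd).
have ih : (mu \x mu)%E.-integrable [set: R * R] h.
  apply/integrable21ltyP => //.
  have E r : (\int[mu]_x `|h (x, r)| = ((b - a) * M)%:E * `|(Pt r)%:E|)%E.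
    under eq_integral => x _.
      rewrite /h /= ger0_norm ?mulr_ge0// EFinM; over.
    rewrite ge0_integralZl_EFin ?mulr_ge0//; last first.
      by apply/measurable_EFinP; exact: measurable_indic.
    rewrite integral_indic// setIT/= lebesgue_measure_itv/= lte_fin ab -!EFinM.
    by congr EFin; ring.
  under eq_integral do rewrite E.
  rewrite ge0_integralZl_EFin//; last 2 first.
  - by apply: measurableT_comp => //; exact/measurable_EFinP.
  - by rewrite mulr_ge0// subr_ge0 ltW.
  apply: lte_mul_pinfty => //.
  - by rewrite lee_fin mulr_ge0// subr_ge0 ltW.
  have -> : (\int[mu]_r `|(Pt r)%:E| = \int[mu]_(r in `]0%R, t[) `|(P r)%:E|)%E.
    rewrite [RHS]integral_mkcond; apply: eq_integral => r _.
    by rewrite /Pt !patchE; case: ifP => //; rewrite abse0.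
  by have /integrableP[] := iP.
have ik : (mu \x mu)%E.-integrable [set: R * R] k.
  apply: (le_integrable _ _ _ ih) => // -[x r] _.
  rewrite /k /h /= lee_fin !normrM normr_id (ger0_norm M0) indicE.
  rewrite mem_setE; case: (boolP (x \in _)) => xab /=; last by rewrite normr0 !mulr0.
  rewrite ler_wpM2r// mulrC /Pt !patchE mem_setE.
  case: ifPn => rt; last by rewrite normr0 !mulr0.
  by rewrite ler_wpM2r// GM//; apply: subset_itv_oo_cc.
have cI1 x : {within `[0, t], continuous (fun r => G (x, r))}.
  exact/continuous_subspaceT/continuous_section1.
have cI2 r : {within `[a, b], continuous (fun x => G (x, r))}.
  exact/continuous_subspaceT/continuous_section2.
pose I x := \int[mu]_(r in `]0, t[) (P r * G (x, r)).
pose N r := P r * \int[mu]_(x in `]a, b[) G (x, r).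
have EF x : (\int[mu]_r k (x, r) = ((I \_ `]a, b[) x)%:E)%E.
  rewrite patchE mem_setE; case: ifPn => xab; last first.
    by apply: integral0_eq => r _; rewrite /k /= indicE mem_setE (negbTE xab) mulr0.
  have i1 : mu.-integrable `]0, t[ (EFin \o (fun r => P r * G (x, r))).
    rewrite (_ : (fun r => _) = (fun r => G (x, r) * P r)); last first.
      by apply/funext => r; rewrite mulrC.
    exact: bounded_integrableM.
  rewrite /I /Rintegral fineK; last exact: integrable_fin_num.
  rewrite [RHS]integral_mkcond; apply: eq_integral => r _.
  rewrite /k /= indicE mem_setE xab mulr1 /Pt !patchE; case: ifP => //.
  by rewrite mul0r.
have EG r : (\int[mu]_x k (x, r) = ((N \_ `]0, t[) r)%:E)%E.
  rewrite patchE mem_setE; case: ifPn => rt; last first.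
    by apply: integral0_eq => x _; rewrite /k /= /Pt patchE mem_setE (negbTE rt) !mul0r.
  have i1 := continuous_integrable_oo (cI2 r).
  rewrite /N -RintegralZl// /Rintegral fineK; last first.
    by apply: integrable_fin_num => //; exact: integrableRZl.
  rewrite [RHS]integral_mkcond; apply: eq_integral => x _.
  rewrite /k /= indicE /Pt !patchE !mem_setE rt.
  by case: ifP; rewrite ?mulr1 ?mulr0.
have EFi : (\int[mu]_x \int[mu]_r k (x, r) = \int[mu]_(x in `]a, b[) (I x)%:E)%E.
  by rewrite [RHS]integral_mkcond; apply: eq_integral => x _; rewrite EF !patchE; case: ifP.
have EGi : (\int[mu]_r \int[mu]_x k (x, r) = \int[mu]_(r in `]0%R, t[) (N r)%:E)%E.
  by rewrite [RHS]integral_mkcond; apply: eq_integral => r _; rewrite EG !patchE; case: ifP.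
have mN : measurable_fun [set: R] ((EFin \o N) \_ `]0, t[).
  have -> : (EFin \o N) \_ `]0, t[ = fun r => (\int[mu]_x k (x, r))%E.
    by apply/funext => r; rewrite EG !patchE; case: ifP.
  exact: measurable_fubini_G ik.
split.
- rewrite integrable_mkcond//.
  have -> : (EFin \o I) \_ `]a, b[ = fun x => (\int[mu]_r k (x, r))%E.
    by apply/funext => x; rewrite EF !patchE; case: ifP.
  exact: integrable_fubini_F ik.
- rewrite integrable_mkcond//; apply/integrableP; split => //.
  have [/(_ ik) + _] := integrable21ltyP mu mu mk; apply: le_lt_trans.
  apply: ge0_le_integral => //.
  + exact: measurableT_comp.
  + have mak : measurable_fun [set: R * R] (abse \o k) by exact: measurableT_comp.
    exact: (measurable_fun_fubini_tonelli_G (m1 := mu) (abse \o k) mak (fun=> abse_ge0 _)).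
  + move=> r _; apply: le_trans (le_abse_integral _ _ _) => //.
      by rewrite EG !patchE; case: ifP.
    exact: (measurableT_comp mk (pair2_measurable r)).
- by rewrite /Rintegral -EGi -EFi (Fubini ik).
Qed.

End space_time_fubini.

(** * One-sided derivatives in space *)

Section within_derivatives.
Context {R : realType}.
Local Notation mu := (@lebesgue_measure R).
Implicit Types (a b x : R) (f g : R -> R).

Lemma within_continuous_comp (X Y T : topologicalType) (A : set X) (G : X -> Y)
    (h : T -> X) (t : T) : {within A, continuous G} -> {for t, continuous h} ->
  (\forall s \near t, A (h s)) -> {for t, continuous (G \o h)}.
Proof.
move=> /subspace_continuousP cG ch nA.
have At : A (h t) := nbhs_singleton nA.
apply: (cvg_comp h G _ (cG _ At)) => P /= nP.
have := ch _ nP; rewrite /nbhs /= => nP'.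
by apply: filterS2 nA nP' => s As; apply.
Qed.

Lemma within_dnbhs_itvoo a b x : x \in `]a, b[ -> within `[a, b] x^' = x^'.
Proof.
move=> xab; apply/seteqP; split => P; last by apply: filterS => y Py _.
rewrite /within /= => H.
have nx : \forall y \near x^', y \in `]a, b[ by apply: nbhs_dnbhs; exact: near_in_itvoo.
apply: filterS2 nx H => y yab; apply.
exact: subset_itv_oo_cc yab.
Qed.

(** Properness makes one-sided limits unique, endpoints included. The witness lies to the right of x
    when x < b, and to the left when x = b. *)
Lemma within_dnbhs_itvcc_proper a b x : a < b -> x \in `[a, b] ->
  ProperFilter (within `[a, b] x^').
Proof.
move=> ab; rewrite in_itv/= => /andP[ax xb].
apply: Build_ProperFilter_ex => P [e /= e0 Pe].
have [xltb|bx] := ltP x b.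
  set m := Num.min b (x + e / 2).
  have mb : m <= b by rewrite ge_min lexx.
  have me : m <= x + e / 2 by rewrite ge_min lexx orbT.
  have xm : x < m by rewrite lt_min xltb ltrDl divr_gt0.
  exists m; apply: Pe => /=.
  - by rewrite ltr_norml; apply/andP; split; lra.
  - by rewrite gt_eqF.
  - by rewrite in_itv/= mb andbT (le_trans ax)// ltW.
have xE : x = b by apply/eqP; rewrite eq_le bx xb.
set m := Num.max a (b - e / 2).
have am : a <= m by rewrite le_max lexx.
have me : b - e / 2 <= m by rewrite le_max lexx orbT.
have mb : m < b by rewrite gt_max ab gtrBl divr_gt0.
exists m; apply: Pe => /=.
- by rewrite ltr_norml; apply/andP; split; lra.
- by rewrite lt_eqF ?xE.
- by rewrite in_itv/= am ltW.
Qed.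

Lemma derive_within_cvg (I : set R) f x : derivable_within I f x ->
  quotient_within f x @ within I x^' --> derive_within I f x.
Proof. by []. Qed.

Lemma derive_within_unique a b f x (l : R) : a < b -> x \in `[a, b] ->
  quotient_within f x @ within `[a, b] x^' --> l -> derive_within `[a, b] f x = l.
Proof.
by move=> ab xab fl; have ? := within_dnbhs_itvcc_proper ab xab; exact: cvg_lim.
Qed.

Lemma derive_within_interior a b f x : x \in `]a, b[ ->
  derivable_within `[a, b] f x -> is_derive x 1 f (derive_within `[a, b] f x).
Proof.
move=> xab /derive_within_cvg; rewrite (within_dnbhs_itvoo xab) => /quotient_cvgP H.
split; first by apply/cvg_ex; exists (derive_within `[a, b] f x).
exact: cvg_lim.
Qed.

(** The relation between g and f is asked on [a, b] only: for the second space derivative, g is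
    itself a derivative relative to [a, b], known as a multiple of f only there. *)
Lemma derive_withinZ a b f g (c x : R) : a < b -> x \in `[a, b] ->
  (forall y, y \in `[a, b] -> g y = c * f y) -> derivable_within `[a, b] f x ->
  derive_within `[a, b] g x = c * derive_within `[a, b] f x.
Proof.
move=> ab xab gf /derive_within_cvg H; apply: derive_within_unique => //.
have : c * quotient_within f x y @[y --> within `[a, b] x^'] -->
    c * derive_within `[a, b] f x by apply: cvgM => //; exact: cvg_cst.
apply: cvg_trans; apply: near_eq_cvg; rewrite near_withinE.
apply: nearW => y yab; rewrite /quotient_within !gf//; ring.
Qed.

Lemma within_ibp a b f : a < b ->
  (forall x, x \in `[a, b] -> derivable_within `[a, b] f x) ->
  (forall x, x \in `[a, b] ->
     derivable_within `[a, b] (derive_within `[a, b] f) x) ->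
  let f1 := derive_within `[a, b] f in
  let f2 := derive_within `[a, b] f1 in
  {within `[a, b], continuous f} -> {within `[a, b], continuous f1} ->
  {within `[a, b], continuous f2} ->
  \int[mu]_(x in `]a, b[) (f x * f2 x) =
    f b * f1 b - f a * f1 a - \int[mu]_(x in `]a, b[) (f1 x ^+ 2).
Proof.
move=> ab df df1 f1 f2 cf cf1 cf2.
have oo g g1 : (forall x, x \in `]a, b[ -> is_derive x 1 g (g1 x)) ->
    {within `[a, b], continuous g} -> derivable_oo_LRcontinuous g a b.
  move=> dg /(continuous_within_itvP _ ab)[_ ga gb]; split => // x xab.
  by have [] := dg x xab.
have d1 x : x \in `]a, b[ -> is_derive x 1 f (f1 x).
  by move=> xab; apply: derive_within_interior => //; apply: df; exact: subset_itv_oo_cc xab.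
have d2 x : x \in `]a, b[ -> is_derive x 1 f1 (f2 x).
  by move=> xab; apply: derive_within_interior => //; apply: df1; exact: subset_itv_oo_cc xab.
have oocc (g : R -> R) : {within `[a, b], continuous g} ->
    \int[mu]_(x in `]a, b[) g x = \int[mu]_(x in `[a, b]) g x.
  move=> cg; rewrite /Rintegral; congr fine.
  have mg : measurable_fun `[a, b] (EFin \o g).
    by apply/measurable_EFinP; exact: subspace_continuous_measurable_fun.
  rewrite -integral_itv_bndo_bndc; last by apply: measurable_funS mg => //; exact: subset_itv_co_cc.
  by rewrite integral_itv_obnd_cbnd//; apply: measurable_funS mg => //; exact: subset_itv_oo_cc.
rewrite !oocc; last 2 first.
- by move=> x; apply: continuousM; [exact: cf1|exact: cf1].
- by move=> x; apply: continuousM; [exact: cf|exact: cf2].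
rewrite (Rintegration_by_parts ab cf1 (oo _ _ d1 cf) _ cf2 (oo _ _ d2 cf1)).
- by congr (_ - _); apply: eq_Rintegral.
- by move=> x xab; rewrite derive1E; have [_ ->] := d1 x xab.
- by move=> x xab; rewrite derive1E; have [_ ->] := d2 x xab.
Qed.

Definition clamp a b x : R := Num.max a (Num.min x b).

Lemma clamp_itvcc a b x : a <= b -> clamp a b x \in `[a, b].
Proof. by move=> ab; rewrite in_itv/= le_max lexx/= ge_max ab ge_min lexx orbT. Qed.

Lemma clamp_id a b x : x \in `[a, b] -> clamp a b x = x.
Proof. by rewrite in_itv/= /clamp => /andP[ax xb]; rewrite min_l// max_r. Qed.

Lemma continuous_clamp a b : continuous (clamp a b).
Proof.
move=> x; have cm : {for x, continuous (fun y => Num.min y b)}.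
  by apply: continuous_min; [exact: cvg_id|exact: cvg_cst].
by apply: (continuous_max _ cm); exact: cvg_cst.
Qed.

(* Constant beyond the boundary of [a, b] x [0, +oo[, so that continuity can be
   stated on the whole plane. *)
Definition clamp_ext a b (u : R -> R -> R) (p : R * R) : R :=
  u (clamp a b p.1) (Num.max 0 p.2).

Lemma clamp_extE a b u x t : x \in `[a, b] -> 0 <= t -> clamp_ext a b u (x, t) = u x t.
Proof. by move=> xab t0; rewrite /clamp_ext /= clamp_id// max_r. Qed.

Lemma continuous_clamp_ext a b u : a <= b ->
  continuous_on2 `[a, b] `[0, +oo[ u -> continuous (clamp_ext a b u).
Proof.
move=> ab cu [y s]; set p := (y, s).
have c1 : {for p, continuous (fun q : R * R => clamp a b q.1)}.
  apply: (@continuous_comp _ _ _ fst (clamp a b)); last exact: continuous_clamp.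
  exact: (@cvg_fst _ _ (nbhs y) (nbhs s)).
have c2 : {for p, continuous (fun q : R * R => Num.max 0 q.2)}.
  by apply: (@continuous_max R (R * R)%type (fun=> 0) snd); [exact: cvg_cst|];
    exact: (@cvg_snd _ _ (nbhs y) (nbhs s)).
apply: (within_continuous_comp (h := fun q : R * R => (clamp a b q.1, Num.max 0 q.2)) cu).
  exact: (cvg_pair c1 c2).
by apply: (@filterE _ (nbhs p)) => q; split; [exact: clamp_itvcc|rewrite /= in_itv/= le_max lexx].
Qed.

End within_derivatives.

(** * The weight exp(lambda t) and the vanishing of the initial values at the endpoints *)

Section weighted_solution.
Context {R : realType}.
Local Notation mu := (@lebesgue_measure R).

(** By the product rule the derivative is a continuous factor times lambda v + v'; here v' is
    integrable on ]0, t[ because g dominates it, and v because it is continuous on [0, t]. *)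
Lemma caputo_regular_expR (lambda t : R) (v g : R -> R) : 0 < t ->
  {within `[0, t], continuous v} ->
  (forall s : R, 0 < s -> derivable v s 1) ->
  (forall s : R, 0 < s -> {for s, continuous (derive1 v)}) ->
  mu.-integrable `]0, t[ (EFin \o g) ->
  (forall s : R, 0 < s -> `|derive1 v s| <= g s) ->
  caputo_regular (fun s => expR (lambda * s) * v s) t.
Proof.
move=> t0 cv dv cv' ig v'g.
have dE (s : R) : is_derive s 1 (fun s => expR (lambda * s)) (lambda * expR (lambda * s)).
  have d1 : is_derive s 1 (fun s : R => lambda *: s) (lambda *: 1).
    exact: (is_deriveZ lambda (is_derive_id s 1)).
  have := is_derive1_comp (g := fun s : R => lambda *: s) (is_derive_expR _) d1.
  by move=> H; apply: (is_derive_eq H); rewrite /GRing.scale/= mulr1 mulrC.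
have cE : continuous (fun s : R => expR (lambda * s)).
  by move=> s; apply: differentiable_continuous; apply/derivable1_diffP; have [] := dE s.
have dw (s : R) : 0 < s -> is_derive s 1 (fun s => expR (lambda * s) * v s)
    (expR (lambda * s) * (lambda * v s) + expR (lambda * s) * derive1 v s).
  move=> s0; have d2 : is_derive s 1 v (derive1 v s).
    by rewrite derive1E; apply: derivableP; exact: dv.
  apply: (is_derive_eq (is_deriveM (dE s) d2)).
  by rewrite /GRing.scale/=; ring.
have cvs (s : R) : 0 < s -> {for s, continuous v}.
  by move=> s0; apply: differentiable_continuous; apply/derivable1_diffP/dv.
have dwE (s : R) : 0 < s -> derive1 (fun s => expR (lambda * s) * v s) s =
    expR (lambda * s) * (lambda * v s) + expR (lambda * s) * derive1 v s.
  by move=> s0; rewrite derive1E; have [_ ->] := dw s s0.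
have cEt : {within `[0, t], continuous (fun s : R => expR (lambda * s))}.
  exact: continuous_subspaceT.
have gt0 (s : R) : s \in `]0, t[ -> 0 < s by rewrite in_itv/= => /andP[].
split.
- by apply/subspace_continuousP => s st; apply: cvgM;
    move: s st; exact/subspace_continuousP.
- by move=> s /gt0 s0; have [] := dw s s0.
- move=> s /gt0 s0.
  suff : derive1 (fun s => expR (lambda * s) * v s) z @[z --> s] -->
      expR (lambda * s) * (lambda * v s) + expR (lambda * s) * derive1 v s.
    by rewrite -dwE.
  have cw : expR (lambda * z) * (lambda * v z) + expR (lambda * z) * derive1 v z @[z --> s] -->
      expR (lambda * s) * (lambda * v s) + expR (lambda * s) * derive1 v s.
    apply: cvgD; apply: cvgM; [exact: cE| |exact: cE|exact: cv'].
    by apply: cvgM; [exact: cvg_cst|exact: cvs].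
  apply: cvg_trans cw; apply: near_eq_cvg.
  by near=> z; rewrite dwE//; near: z; exact: lt_nbhsr.
have iv : mu.-integrable `]0, t[ (EFin \o (fun s => lambda * v s)).
  by apply: integrableRZl => //; exact: continuous_integrable_oo.
have iv' : mu.-integrable `]0, t[ (EFin \o derive1 v).
  apply: (le_integrable _ _ _ ig) => //.
    apply/measurable_EFinP; apply: open_continuous_measurable_fun => //.
    by move=> s; rewrite inE => /gt0; exact: cv'.
  move=> s /gt0 s0; rewrite /= lee_fin (le_trans (v'g s s0))// ler_norm//.
have iw : mu.-integrable `]0, t[ (EFin \o (fun s =>
    expR (lambda * s) * (lambda * v s) + expR (lambda * s) * derive1 v s)).
  by apply: integrableRD => //; apply: bounded_integrableM.
apply: eq_integrable iw => //.
by move=> s; rewrite inE => /gt0 s0; rewrite /= dwE.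
Unshelve. all: by end_near. Qed.

(** The support is closed and misses c, so h vanishes near c, and f c is a limit of values of h. The
    filter F is a one-sided neighbourhood of an endpoint, as f and h are known to agree only inside
    the interval. *)
Lemma continuous_eq0_supp (F : set_system R) (c : R) (f h : R -> R) :
  ProperFilter F -> F `=>` nbhs c -> {for c, continuous f} -> ~ supp h c ->
  (\forall x \near F, f x = h x) -> f c = 0.
Proof.
move=> PF Fc cf hc fh.
have cvf : f @ F --> f c := cvg_trans (cvg_app f Fc) cf.
have oh : open (~` supp h) by apply: closed_openC; exact: closed_closure.
have nh : \forall x \near F, h x = 0.
  have nc : nbhs c (~` supp h) by exact: open_nbhs_nbhs.
  apply: filterS (Fc _ nc) => x sx; apply/eqP; apply: contrapT => /negP hx.
  by apply: sx; apply: subset_closure.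
have cv0 : f @ F --> (0 : R).
  apply: (@cvg_trans _ (cst (0 : R) @ F)); last exact: cvg_cst.
  by apply: near_eq_cvg; apply: filterS2 fh nh => x -> ->.
exact: (cvg_unique _ cvf cv0).
Qed.

End weighted_solution.

(** * The energy estimate *)

(** The problem enters only through a time inequality at each interior x, an integration by parts at
    each r, and the signs of two boundary integrals. Integrability is part of the conclusion because
    it is needed to pull the factor exp(-2 lambda t) out of the tempered integral. *)
Lemma energy_estimate (R : realType) (gamma kappa a b t : R) (W W1 W2 : R * R -> R) :
  let mu := @lebesgue_measure R in
  0 < gamma < 1 -> 0 < kappa -> a < b -> 0 < t ->
  continuous W -> continuous W1 -> continuous W2 ->
  (forall x, x \in `]a, b[ -> Gamma gamma * (W (x, t) ^+ 2 - W (x, 0) ^+ 2) <=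
     2 * kappa * \int[mu]_(r in `]0, t[) ((t - r) `^ (gamma - 1) * (W (x, r) * W2 (x, r)))) ->
  (forall r, r \in `]0, t[ -> \int[mu]_(x in `]a, b[) (W (x, r) * W2 (x, r)) =
     W (b, r) * W1 (b, r) - W (a, r) * W1 (a, r) -
     \int[mu]_(x in `]a, b[) (W1 (x, r) ^+ 2)) ->
  \int[mu]_(r in `]0, t[) ((t - r) `^ (gamma - 1) * (W (b, r) * W1 (b, r))) <= 0 ->
  0 <= \int[mu]_(r in `]0, t[) ((t - r) `^ (gamma - 1) * (W (a, r) * W1 (a, r))) ->
  mu.-integrable `]0, t[ (EFin \o (fun r =>
    (t - r) `^ (gamma - 1) * \int[mu]_(x in `]a, b[) (W1 (x, r) ^+ 2))) /\
  Gamma gamma * (\int[mu]_(x in `]a, b[) (W (x, t) ^+ 2) -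
                 \int[mu]_(x in `]a, b[) (W (x, 0) ^+ 2)) +
  2 * kappa * \int[mu]_(r in `]0, t[)
    ((t - r) `^ (gamma - 1) * \int[mu]_(x in `]a, b[) (W1 (x, r) ^+ 2)) <= 0.
Proof.
move=> mu g01 k0 ab t0 cW cW1 cW2 H1 H2 Hb Ha.
pose P r := (t - r) `^ (gamma - 1).
have iP : mu.-integrable `]0, t[ (EFin \o P) := integrable_RL_kernel g01 t0.
pose G p := W p * W2 p.
have cG : continuous G by move=> p; apply: cvgM; [exact: cW|exact: cW2].
have [iI iPG swap] := space_time_fubini ab iP cG.
have iPbd c : mu.-integrable `]0, t[ (EFin \o (fun r => P r * (W (c, r) * W1 (c, r)))).
  rewrite (_ : (fun r => _) = fun r => (W (c, r) * W1 (c, r)) * P r); last first.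
    by apply/funext => r; rewrite mulrC.
  apply: bounded_integrableM => //; apply: continuous_subspaceT.
  by move=> r; apply: cvgM; apply: continuous_section1.
pose N r := \int[mu]_(x in `]a, b[) (W1 (x, r) ^+ 2).
(* The integration by parts, multiplied by the kernel, also yields the integrability of [P r * N r]
   from that of the other three terms. *)
have PNE r : r \in `]0, t[ -> P r * N r = P r * (W (b, r) * W1 (b, r)) -
    P r * (W (a, r) * W1 (a, r)) - P r * \int[mu]_(x in `]a, b[) G (x, r).
  by move=> rt; rewrite H2// -/(N r); ring.
have ibd : mu.-integrable `]0, t[ (EFin \o (fun r => P r * (W (b, r) * W1 (b, r)) -
    P r * (W (a, r) * W1 (a, r)))) by exact: integrableRB.
have iPN : mu.-integrable `]0, t[ (EFin \o (fun r => P r * N r)).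
  apply: eq_integrable (integrableRB _ ibd iPG) => //.
  by move=> r; rewrite inE => rt; rewrite /= PNE.
split => //.
have PN : \int[mu]_(r in `]0, t[) (P r * N r) =
    \int[mu]_(r in `]0, t[) (P r * (W (b, r) * W1 (b, r))) -
    \int[mu]_(r in `]0, t[) (P r * (W (a, r) * W1 (a, r))) -
    \int[mu]_(r in `]0, t[) (P r * \int[mu]_(x in `]a, b[) G (x, r)).
  rewrite -!RintegralB//; apply: eq_Rintegral => r; rewrite inE; exact: PNE.
have isq s : mu.-integrable `]a, b[ (EFin \o (fun x => W (x, s) ^+ 2)).
  apply: continuous_integrable_oo; apply: continuous_subspaceT.
  by move=> x; apply: cvgM; apply: continuous_section2.
have S1 : Gamma gamma * (\int[mu]_(x in `]a, b[) (W (x, t) ^+ 2) -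
      \int[mu]_(x in `]a, b[) (W (x, 0) ^+ 2)) <=
    2 * kappa * \int[mu]_(r in `]0, t[) (P r * \int[mu]_(x in `]a, b[) G (x, r)).
  rewrite -swap -RintegralB// -!RintegralZl//; last exact: integrableRB.
  by apply: le_Rintegral => //; apply: integrableRZl => //; exact: integrableRB.
rewrite -/(N _) -/(P _) in Hb Ha *.
have := ler_wpM2l (ltW k0) Hb; have := mulr_ge0 (ltW k0) Ha.
rewrite -/(P _) PN; lra.
Qed.

Theorem theorem2 (R : realType) (gamma kappa lambda xl xr : R)
    (u0 : R -> R) (u : R -> R -> R) :
  let Omega : set R := `]xl, xr[%classic in
  let cOmega : set R := `[xl, xr]%classic in
  let w : R -> R -> R := fun x t => expR (lambda * t) * u x t in
  0 < gamma < 1 -> 0 < kappa -> 0 <= lambda -> xl < xr ->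
  supp u0 `<=` Omega ->
  regular_in_space cOmega u ->
  regular_in_time cOmega u ->
  (forall x t : R, Omega x -> 0 < t -> caputo_exists gamma (w x) t) ->
  (forall t : R, 0 < t -> caputo_exists (gamma / 2) (w xl) t) ->
  (forall t : R, 0 < t -> caputo_exists (gamma / 2) (w xr) t) ->
  (forall x t : R, Omega x -> 0 < t ->
     caputo gamma (w x) t = kappa * dx cOmega (dx cOmega w) x t) ->
  (forall x : R, Omega x -> u x 0 = u0 x) ->
  (forall t : R, 0 < t ->
     dx cOmega w xl t = (Num.sqrt kappa)^-1 * caputo (gamma / 2) (w xl) t) ->
  (forall t : R, 0 < t ->
     dx cOmega w xr t = - (Num.sqrt kappa)^-1 * caputo (gamma / 2) (w xr) t) ->
  forall t : R, 0 < t ->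
    sqL2norm Omega (u^~ t) +
      2 * kappa * tempered_RL gamma (2 * lambda)
                    (fun s => sqL2norm Omega ((dx cOmega u)^~ s)) t
    <= expR (- (2 * lambda * t)) * sqL2norm Omega u0.
Proof.
move=> Omega cOmega w g01 k0 _ lr suppu0 [du cu cux cuxx] [dtu cdtu [g [ig dtg]]].
move=> cex cexl cexr eqw ic bcl bcr t t0.
have /andP[g0 g1] := g01.
have OcO x : Omega x -> cOmega x by exact: subset_itv_oo_cc.
have lcO : cOmega xl by rewrite /cOmega /= in_itv/= lexx ltW.
have rcO : cOmega xr by rewrite /cOmega /= in_itv/= lexx ltW.
pose E s := expR (lambda * s).
have E0 s : 0 < E s by exact: expR_gt0.
have cE : continuous (fun p : R * R => E p.2).
  move=> p; apply: (@continuous_comp _ _ _ snd E).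
    by case: p => y s; exact: (@cvg_snd _ _ (nbhs y) (nbhs s)).
  apply: continuous_comp; last exact: continuous_expR.
  exact: mulrl_continuous.
(* The continuity hypotheses concern u, so the weighted functions are built from u and its space
   derivatives and extended to the plane; on the closed strip they are then shown to equal w, w_x
   and w_xx. *)
pose ext v (p : R * R) := E p.2 * clamp_ext xl xr v p.
have cext v : continuous_on2 cOmega `[0, +oo[ v -> continuous (ext v).
  move=> cv p; apply: cvgM; first exact: cE.
  by apply: continuous_clamp_ext cv _; exact: ltW.
have extE v x s : cOmega x -> 0 <= s -> ext v (x, s) = E s * v x s.
  by move=> cx s0; rewrite /ext /= clamp_extE.
pose W := ext u; pose W1 := ext (dx cOmega u); pose W2 := ext (dx cOmega (dx cOmega u)).
have [cW cW1 cW2] : [/\ continuous W, continuous W1 & continuous W2].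
  by split; exact: cext.
have wW x s : cOmega x -> 0 <= s -> w x s = W (x, s) by move=> ? ?; rewrite [RHS]extE.
have dwE x s : cOmega x -> 0 <= s -> dx cOmega w x s = E s * dx cOmega u x s.
  move=> cx s0; apply: (derive_withinZ lr cx) => //.
  by have [] := du x s cx s0.
have ddwE x s : cOmega x -> 0 <= s ->
    dx cOmega (dx cOmega w) x s = E s * dx cOmega (dx cOmega u) x s.
  move=> cx s0; apply: (derive_withinZ lr cx); last by have [] := du x s cx s0.
  by move=> y cy; exact: dwE.
have dwW x s : cOmega x -> 0 <= s -> dx cOmega w x s = W1 (x, s).
  by move=> cx s0; rewrite dwE// [RHS]extE.
have ddwW x s : cOmega x -> 0 <= s -> dx cOmega (dx cOmega w) x s = W2 (x, s).
  by move=> cx s0; rewrite ddwE// [RHS]extE.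
have reg x : cOmega x -> caputo_regular (w x) t.
  move=> cx; apply: (@caputo_regular_expR _ lambda t (u x) g) => //.
  - have cux0 : {within `[0, t], continuous (fun s => clamp_ext xl xr u (x, s))}.
      apply: continuous_subspaceT; apply: continuous_section1.
      by apply: continuous_clamp_ext cu; exact: ltW.
    apply: subspace_eq_continuous cux0 => s; rewrite inE/= in_itv/= => /andP[s0 _].
    exact: clamp_extE.
  - by move=> s s0; exact: dtu.
  - move=> s s0.
    apply: (within_continuous_comp (h := fun s : R => (x, s)) cdtu).
      by apply: (@cvg_pair _ _ _ (nbhs s) (nbhs x) (nbhs s)); [exact: cvg_cst|exact: cvg_id].
    near=> z; split => //=; rewrite in_itv/= andbT; near: z; exact: lt_nbhsr.
  - exact: ig.
  - by move=> s s0; exact: dtg.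
have oo0 (r : R) : r \in `]0, t[ -> 0 < r by rewrite in_itv/= => /andP[].
have iWV (V : R * R -> R) x : continuous V ->
    lebesgue_measure.-integrable `]0, t[
      (EFin \o (fun r => (t - r) `^ (gamma - 1) * (W (x, r) * V (x, r)))).
  move=> cV.
  rewrite (_ : (fun r => _) = fun r => (W (x, r) * V (x, r)) * (t - r) `^ (gamma - 1)).
    apply: bounded_integrableM; last exact: integrable_RL_kernel.
    apply: continuous_subspaceT.
    by move=> r; apply: cvgM; apply: continuous_section1.
  by apply/funext => r; rewrite mulrC.
have interior x : x \in `]xl, xr[ -> Gamma gamma * (W (x, t) ^+ 2 - W (x, 0) ^+ 2) <=
    2 * kappa * \int[lebesgue_measure]_(r in `]0, t[)
      ((t - r) `^ (gamma - 1) * (W (x, r) * W2 (x, r))).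
  move=> xO; have cx := OcO _ xO.
  (* By the equation the Caputo derivative is kappa w_xx, continuous up to time 0; this provides the
     integrability in [iH]. *)
  have eqH r : r \in `]0, t[ -> (t - r) `^ (gamma - 1) * (w x r * caputo gamma (w x) r) =
      kappa * ((t - r) `^ (gamma - 1) * (W (x, r) * W2 (x, r))).
    by move=> /oo0 r0; rewrite eqw// ddwW ?ltW// wW ?ltW//; ring.
  have iH : lebesgue_measure.-integrable `]0, t[
      (EFin \o (fun r => (t - r) `^ (gamma - 1) * (w x r * caputo gamma (w x) r))).
    apply: eq_integrable (integrableRZl kappa _ (iWV _ x cW2)) => //.
    by move=> r; rewrite inE => rt; rewrite /= eqH.
  have iK r : r \in `]0, t[ ->
      lebesgue_measure.-integrable `]0, r[ (EFin \o caputo_kernel gamma (w x) r).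
    by move=> /oo0 r0; have [] := cex x r xO r0.
  have := RL_caputo_sqr_ge g01 t0 (reg x cx) iK iH.
  rewrite (wW _ _ cx (ltW t0)) (wW _ _ cx (lexx 0)) -mulrA -RintegralZl//; last exact: iWV.
  congr (_ <= 2 * _); apply: eq_Rintegral => r; rewrite inE; exact: eqH.
(* One statement for both endpoints: c is the square root of kappa at [xl] and its opposite at [xr],
   so that each boundary condition reads D^(gamma/2) w = c w_x. *)
have boundary (x c : R) : cOmega x -> c != 0 -> u x 0 = 0 ->
    (forall r, 0 < r -> caputo_exists (gamma / 2) (w x) r) ->
    (forall r, 0 < r -> caputo (gamma / 2) (w x) r = c * dx cOmega w x r) ->
    0 <= c * \int[lebesgue_measure]_(r in `]0, t[)
      ((t - r) `^ (gamma - 1) * (W (x, r) * W1 (x, r))).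
  move=> cx c0 ux0 ex bc.
  have eqH r : r \in `]0, t[ ->
      (t - r) `^ (gamma - 1) * (w x r * caputo (gamma / 2) (w x) r) =
      c * ((t - r) `^ (gamma - 1) * (W (x, r) * W1 (x, r))).
    by move=> /oo0 r0; rewrite bc// dwW ?ltW// wW ?ltW//; ring.
  have iH : lebesgue_measure.-integrable `]0, t[
      (EFin \o (fun r => (t - r) `^ (gamma - 1) * (w x r * caputo (gamma / 2) (w x) r))).
    apply: eq_integrable (integrableRZl c _ (iWV _ x cW1)) => //.
    by move=> r; rewrite inE => rt; rewrite /= eqH.
  have iK r : r \in `]0, t[ ->
      lebesgue_measure.-integrable `]0, r[ (EFin \o caputo_kernel (gamma / 2) (w x) r).
    by move=> /oo0 r0; have [] := ex r r0.
  have wx0 : w x 0 = 0 by rewrite /w ux0 mulr0.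
  have h0 : 0 < gamma / 2 by lra.
  have hg : gamma / 2 < gamma by lra.
  have := RL_caputo_sqr_ge0 h0 hg g1 t0 (reg x cx) wx0 iK iH.
  rewrite -RintegralZl//; last exact: iWV.
  congr (_ <= _); apply: eq_Rintegral => r; rewrite inE; exact: eqH.
have E00 : E 0 = 1 by rewrite /E mulr0 expR0.
have cW0 : continuous (fun x => W (x, 0)) by exact: continuous_section2.
have W0 x : Omega x -> W (x, 0) = u0 x.
  by move=> xO; rewrite [LHS]extE ?E00 ?mul1r ?ic//; exact: OcO.
have ul0 : u xl 0 = 0.
  suff : W (xl, 0) = 0 by rewrite [LHS]extE// E00 mul1r.
  apply: (@continuous_eq0_supp _ xl^'+ xl (fun x => W (x, 0)) u0) => //.
  - exact: cvg_within.
  - exact: cW0.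
  - by move=> /suppu0; rewrite /Omega/= in_itv/= ltxx.
  - near=> x; apply: W0; rewrite /Omega/= in_itv/=; apply/andP; split; near: x.
      exact: nbhs_right_gt.
    exact: nbhs_right_lt.
have ur0 : u xr 0 = 0.
  suff : W (xr, 0) = 0 by rewrite [LHS]extE// E00 mul1r.
  apply: (@continuous_eq0_supp _ xr^'- xr (fun x => W (x, 0)) u0) => //.
  - exact: cvg_within.
  - exact: cW0.
  - by move=> /suppu0; rewrite /Omega/= in_itv/= ltxx andbF.
  - near=> x; apply: W0; rewrite /Omega/= in_itv/=; apply/andP; split; near: x.
      exact: nbhs_left_gt.
    exact: nbhs_left_lt.
have sk0 : 0 < Num.sqrt kappa by rewrite sqrtr_gt0.
have skn0 : Num.sqrt kappa != 0 by rewrite gt_eqF.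
have Hl : 0 <= \int[lebesgue_measure]_(r in `]0, t[)
    ((t - r) `^ (gamma - 1) * (W (xl, r) * W1 (xl, r))).
  rewrite -(pmulr_rge0 _ sk0); apply: boundary => // r r0.
  by rewrite bcl// mulVKf.
have Hr : \int[lebesgue_measure]_(r in `]0, t[)
    ((t - r) `^ (gamma - 1) * (W (xr, r) * W1 (xr, r))) <= 0.
  rewrite -(pmulr_rle0 _ sk0) -oppr_ge0 -mulNr.
  apply: boundary => //; first by rewrite oppr_eq0.
  by move=> r r0; rewrite bcr// mulrA mulrNN mulfV// mul1r.
have ibp r : r \in `]0, t[ -> \int[lebesgue_measure]_(x in `]xl, xr[) (W (x, r) * W2 (x, r)) =
    W (xr, r) * W1 (xr, r) - W (xl, r) * W1 (xl, r) -
    \int[lebesgue_measure]_(x in `]xl, xr[) (W1 (x, r) ^+ 2).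
  move=> /oo0/ltW r0.
  have cdu v : continuous_on2 cOmega `[0, +oo[ v -> {within cOmega, continuous v^~ r}.
    move=> cv; have cc : {within cOmega, continuous (fun x => clamp_ext xl xr v (x, r))}.
      apply: continuous_subspaceT; apply: continuous_section2.
      by apply: continuous_clamp_ext cv; exact: ltW.
    by apply: subspace_eq_continuous cc => x; rewrite inE => cx; exact: clamp_extE.
  have iM (v1 v2 : R -> R) : {within cOmega, continuous v1} -> {within cOmega, continuous v2} ->
      lebesgue_measure.-integrable `]xl, xr[ (EFin \o (fun x => v1 x * v2 x)).
    move=> c1 c2; apply: continuous_integrable_oo.
    by move=> x; apply: continuousM; [exact: c1|exact: c2].
  (* Integration by parts is done for u at fixed time; each term of the identity for W then carries
     the constant factor [E r ^+ 2]. *)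
  have ibp_u := @within_ibp R xl xr (u^~ r) lr (fun x cx => (du x r cx r0).1)
    (fun x cx => (du x r cx r0).2) (cdu _ cu) (cdu _ cux) (cdu _ cuxx).
  have -> : \int[lebesgue_measure]_(x in `]xl, xr[) (W (x, r) * W2 (x, r)) =
      E r ^+ 2 * \int[lebesgue_measure]_(x in `]xl, xr[)
        (u x r * dx cOmega (dx cOmega u) x r).
    rewrite -[RHS]RintegralZl; [|exact: measurable_itv|exact: iM (cdu _ cu) (cdu _ cuxx)].
    apply: eq_Rintegral => x; rewrite inE => /OcO cx.
    by rewrite [W _](extE u)// [W2 _](extE (dx cOmega (dx cOmega u)))// mulrACA.
  have -> : \int[lebesgue_measure]_(x in `]xl, xr[) (W1 (x, r) ^+ 2) =
      E r ^+ 2 * \int[lebesgue_measure]_(x in `]xl, xr[) (dx cOmega u x r ^+ 2).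
    rewrite -[RHS]RintegralZl; [|exact: measurable_itv|exact: iM (cdu _ cux) (cdu _ cux)].
    apply: eq_Rintegral => x; rewrite inE => /OcO cx.
    by rewrite [W1 _]extE// exprMn.
  rewrite [X in _ * X = _]ibp_u [W (xr, _)]extE// [W1 (xr, _)]extE//
    [W (xl, _)]extE// [W1 (xl, _)]extE//.
  rewrite -/(dx cOmega u xr r) -/(dx cOmega u xl r); ring.
have [iPN key] := energy_estimate g01 k0 lr t0 cW cW1 cW2 interior ibp Hr Hl.
have sqE v s : 0 <= s -> continuous (ext v) ->
    sqL2norm Omega (v^~ s) =
      E s ^- 2 * \int[lebesgue_measure]_(x in `]xl, xr[) (ext v (x, s) ^+ 2).
  move=> s0 cv; rewrite -RintegralZl//; last first.
    apply: continuous_integrable_oo; apply: continuous_subspaceT.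
    by move=> x; apply: cvgM; apply: continuous_section2.
  apply: eq_Rintegral => x; rewrite inE => /OcO cx.
  by rewrite extE// exprMn mulKf// expf_neq0// gt_eqF.
have u0E : sqL2norm Omega u0 =
    \int[lebesgue_measure]_(x in `]xl, xr[) (W (x, 0) ^+ 2).
  by apply: eq_Rintegral => x; rewrite inE => xO; rewrite W0.
have RLE : tempered_RL gamma (2 * lambda) (fun s => sqL2norm Omega ((dx cOmega u)^~ s)) t =
    (Gamma gamma)^-1 * (E t ^- 2 * \int[lebesgue_measure]_(r in `]0, t[)
    ((t - r) `^ (gamma - 1) * \int[lebesgue_measure]_(x in `]xl, xr[) (W1 (x, r) ^+ 2))).
  rewrite /tempered_RL; congr (_ * _).
  rewrite -[RHS]RintegralZl; [|exact: measurable_itv|exact: iPN].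
  apply: eq_Rintegral => r; rewrite inE => /oo0/ltW r0.
  (* The tempering kernel splits into a factor of t, which leaves the integral, and a factor of r,
     which cancels the [E r ^- 2] coming from the norm of u_x. *)
  rewrite sqE// (_ : expR (- (2 * lambda) * (t - r)) = E t ^- 2 * E r ^+ 2).
    by field; rewrite !gt_eqF.
  rewrite /E -!expRM_natl -expRN -expRD; congr expR; ring.
have G0 : 0 < Gamma gamma by exact: Gamma_gt0.
have EE : expR (- (2 * lambda * t)) = E t ^- 2.
  by rewrite /E -expRM_natl -expRN; congr expR; ring.
rewrite (sqE u t (ltW t0) cW) RLE EE u0E -[ext u]/W.
have q0 : 0 < E t ^- 2 by rewrite invr_gt0 exprn_gt0.
set q := E t ^- 2 in q0 *.
(* The difference of the two sides is exactly the left-hand side of [key] multiplied by the positive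
   number q / Gamma gamma. *)
rewrite -subr_le0; apply: le_trans (mulr_ge0_le0 (ltW (divr_gt0 q0 G0)) key).
rewrite le_eqVlt; apply/orP; left; apply/eqP.
by field; rewrite gt_eqF.
Unshelve. all: by end_near. Qed.
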